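(* Let $n\ge1$, let $\mu$ be a Borel probability measure on $\mathbb R^n$ with $\mu(\{\mathbf 0\})<1$, let $\kappa$ be a Borel probability measure on $\mathcal S^{n-1}$, and let $(Z_t)_{t\ge0}$ be a Walsh Brownian motion with spinning measure $\kappa$ started at $\mathbf 0$. If there exists a stopping time $\tau$ such that $Z_\tau\sim\mu$ and $\mathbb E[\tau]<+\infty$, then $$\kappa(d\gamma)=\frac{m_\gamma}{m}\,\tilde\mu_1(d\gamma),$$ where $m=\int_{\mathbb R^n}|z|\,\mu(dz)$ is a positive (finite) constant. Moreover, the second moment of $\mu$ is finite: $\int_{\mathbb R^n}|z|^2\,\mu(dz)<+\infty$.
   Context: Notation: $\mathcal S^{n-1}$ is the unit sphere of $\mathbb R^n$, $\mathbf 0$ the origin, $\mathbb R_+=(0,\infty)$. Points are written in polar coordinates $z=(\gamma,r)$, $z=\gamma r$; all $(\gamma,0)$ are identified with $\mathbf 0$. For a function $f$ write $f_\gamma(r)=f(\gamma,r)$. Walsh Brownian motion with spinning measure $\kappa$: let $E=\{(\gamma,r):\gamma\in\mathrm{supp}(\kappa),\ r\ge 0\}$, and let $(P^+_t)$ and $(P^0_t)$ be the semigroups on $[0,\infty)$ of reflecting Brownian motion and of Brownian motion killed at $0$, respectively. For $f\in\mathcal C_0(E)$ put $\bar f(r)=\int f(\gamma,r)\,\kappa(d\gamma)$ and $$P_tf(\gamma,0)=P_t^+\bar f(0),\qquad P_tf(\gamma,r)=P_t^+\bar f(r)+P_t^0(f_\gamma-\bar f)(r)\quad(r>0).$$ This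 is a Feller semigroup; the Walsh Brownian motion $Z_t=(\Gamma_t,R_t)$ is the continuous strong Markov process on $E$ with this semigroup. Its radial part $R_t$ is a reflecting Brownian motion; by convention $\Gamma_t=(1,0,\dots,0)$ when $R_t=0$. Stopping times are with respect to a filtration for which $Z$ is strong Markov (possibly enlarged by independent randomness at time $0$). The measure $\tilde\mu$: let $\tilde\mu$ on $\mathcal S^{n-1}\times\mathbb R_+$ be the push-forward of $\mu|_{\mathbb R^n\setminus\{\mathbf 0\}}$ under $z=\gamma r\mapsto(\gamma,r)$. With $k=\mu(\{\mathbf 0\})$, extend it to a probability measure on $\mathcal S^{n-1}\times[0,\infty)$ by $\tilde\mu(A\times\{0\})=\frac{k}{1-k}\tilde\mu(A\times\mathbb R_+)$ for Borel $A\subset\mathcal S^{n-1}$. Let $\tilde\mu_1$ be the first marginal of $\tilde\mu$, $(\tilde\mu_\gamma)_{\gamma\in\mathcal S^{n-1}}$ the disintegration of $\tilde\mu$ with respect to $\tilde\mu_1$ (probability measures on $[0,\infty)$), and $m_\gamma=\int_{[0,\infty)}r\,\tilde\mu_\gamma(dr)$. *)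

(* Defs.v *)
From HB Require Import structures.
From mathcomp Require Import all_boot all_order all_algebra.
From mathcomp Require Import all_classical all_reals all_analysis.

Set Implicit Arguments.
Unset Strict Implicit.
Unset Printing Implicit Defensive.

Import Order.TTheory GRing.Theory Num.Theory.
Import numFieldNormedType.Exports.

Local Open Scope classical_set_scope.
Local Open Scope ring_scope.

Notation borel T := (g_sigma_algebraType (@open T)).

Section Euclidean.
Context {R : realType} {n : nat}.
Implicit Types z : 'rV[R]_n.+1.

(* The library norm on matrices is the sup norm; its topology, hence the
   Borel sigma-algebra, is the usual one. *)
Definition enorm z : R := Num.sqrt (\sum_i z ord0 i ^+ 2).

Definition unit_sphere : set 'rV[R]_n.+1 := [set z | enorm z = 1].

Definition pole_vec : 'rV[R]_n.+1 := delta_mx ord0 ord0.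

Lemma pole_vec_unit : pole_vec \in unit_sphere.
Proof.
rewrite inE /unit_sphere /= /enorm (bigD1 ord0)//= big1 => [|i i0].
  by rewrite !mxE !eqxx/= expr1n addr0 sqrtr1.
by rewrite !mxE eqxx/= (negbTE i0) expr0n.
Qed.

Lemma enorm_ge0 z : 0 <= enorm z. Proof. exact: sqrtr_ge0. Qed.

Lemma enormZ (a : R) z : enorm (a *: z) = `|a| * enorm z.
Proof.
rewrite /enorm; under eq_bigr do rewrite mxE exprMn.
by rewrite -mulr_sumr sqrtrM ?sqr_ge0// sqrtr_sqr.
Qed.

Lemma enorm0 : enorm 0 = 0.
Proof. by rewrite -(scale0r 0) enormZ normr0 mul0r. Qed.

Lemma enorm_eq0 z : (enorm z == 0) = (z == 0).
Proof.
apply/idP/eqP => [|->]; last by rewrite enorm0.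
rewrite sqrtr_eq0 => h; apply/rowP => i; rewrite !mxE; apply/eqP.
rewrite -sqrf_eq0 eq_le sqr_ge0 andbT (le_trans _ h)//.
by rewrite (bigD1 i)//= lerDl sumr_ge0// => j _; exact: sqr_ge0.
Qed.

Lemma normalized_unit z : z != 0 -> (enorm z)^-1 *: z \in unit_sphere.
Proof.
move=> z0; rewrite inE /unit_sphere /= enormZ ger0_norm ?invr_ge0 ?enorm_ge0//.
by rewrite mulVf// enorm_eq0.
Qed.

Lemma enorm_continuous : continuous (@enorm).
Proof.
have H : continuous (fun z : 'rV[R]_n.+1 => \sum_i z ord0 i ^+ 2).
  apply: (@continuous_big R^o) => [|i _ z]; first exact: add_continuous.
  apply: (@continuous_comp _ _ _ (fun x : 'rV[R]_n.+1 => x ord0 i) (fun x : R => x ^+ 2)); last exact: exprn_continuous.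
  exact: coord_continuous.
by move=> z; apply: continuous_comp; [exact: H|exact: sqrt_continuous].
Qed.

End Euclidean.
Arguments unit_sphere : clear implicits.

(* [sphere R n] lives in R^(n+1). *)
Definition sphere (R : realType) (n : nat) := set_type (unit_sphere R n).

HB.instance Definition _ R n := Choice.on (sphere R n).
HB.instance Definition _ R n := SubType.on (sphere R n).
HB.instance Definition _ R n := Topological.on (sphere R n).
HB.instance Definition _ (R : realType) n :=
  isPointed.Build (sphere R n) (Sub pole_vec pole_vec_unit).

Section PolarCoordinates.
Context {R : realType} {n : nat}.
Implicit Types (z : 'rV[R]_n.+1) (g : sphere R n).

Definition pole : sphere R n := Sub pole_vec pole_vec_unit.

(* Equal to (1,0,...,0) at the origin. *)
Definition direction z : sphere R n := insubd pole ((enorm z)^-1 *: z).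

Definition polar (z : borel 'rV[R]_n.+1) : borel (sphere R n) * R :=
  (direction z, enorm z).

Definition polar0 (z : borel 'rV[R]_n.+1) : borel (sphere R n) * R :=
  (direction z, 0).

Definition punctured : set 'rV[R]_n.+1 := [set z | z != 0].

Lemma val_direction z : z != 0 -> val (direction z) = (enorm z)^-1 *: z.
Proof. by move=> z0; rewrite insubdK// normalized_unit. Qed.

Lemma direction0 : direction 0 = pole.
Proof.
rewrite /direction /insubd insubN// scaler0; apply/negP; rewrite inE /unit_sphere/=.
by rewrite enorm0 => /esym/eqP; rewrite oner_eq0.
Qed.

Lemma punctured_open : open punctured.
Proof.
rewrite (_ : punctured = enorm @^-1` [set x | x != 0]).
  apply: open_comp; first by move=> z _; exact: enorm_continuous.
  exact: open_neq.
by apply/seteqP; split=> z /=; rewrite /punctured/= enorm_eq0.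
Qed.

Lemma setC_punctured : ~` punctured = [set 0].
Proof.
apply/seteqP; split=> z /=; rewrite /punctured/=; last by move=> ->; rewrite eqxx.
by move=> z0; apply/eqP; apply: contra_notT z0.
Qed.

Lemma measurable_punctured : measurable (punctured : set (borel _)).
Proof. by apply: sub_sigma_algebra; exact: punctured_open. Qed.

Lemma measurable_enorm :
  measurable_fun [set: borel 'rV[R]_n.+1] (@enorm R n : borel _ -> R).
Proof.
apply: (measurability _ (measurable_realfun.RGenOpens.measurableE R)).
move=> _ [_ [a [b ->] <-]]; rewrite setTI; apply: sub_sigma_algebra.
apply: open_comp; first by move=> z _; exact: enorm_continuous.
exact: interval_open.
Qed.

Lemma measurable_direction :
  measurable_fun [set: borel 'rV[R]_n.+1]
    (direction : borel _ -> borel (sphere R n)).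
Proof.
apply: (@measurability _ _ (borel 'rV[R]_n.+1) (borel (sphere R n)) setT direction
  (@open (sphere R n)) erefl).
move=> _ [_ [U oU <-] <-]; rewrite setTI.
pose f z := (enorm z)^-1 *: z.
have oW : open (punctured `&` f @^-1` U).
  rewrite openE => z [/= z0 Ufz]; apply: filterI.
    by apply: open_nbhs_nbhs; split => //; exact: punctured_open.
  have : f @ z --> f z.
    have ez : enorm z != 0 by rewrite enorm_eq0.
    have V := @cvgV R _ (nbhs z) (nbhs_filter z) _ _ ez (@enorm_continuous R n z).
    exact: (@cvgZ R _ _ (nbhs z) (nbhs_filter z) _ _ _ _ V (@cvg_id _ (nbhs z))).
  by apply; exact: open_nbhs_nbhs.
have -> : direction @^-1` (set_val @^-1` U) =
    (punctured `&` f @^-1` U) `|` (~` punctured `&` [set _ | U (val pole)]).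
  apply/seteqP; split=> z /=.
    have [->|z0] := eqVneq z 0.
      by rewrite direction0 => h; right; split => //; rewrite /punctured/= eqxx.
    by rewrite set_valE/= val_direction// => h; left.
  move=> [[z0 h]|[z0 h]]; first by rewrite set_valE/= val_direction.
  suff -> : z = 0 by rewrite direction0.
  by apply/eqP; apply: contra_notT z0.
apply: measurableU; first exact: sub_sigma_algebra.
apply: measurableI; first by apply: measurableC; exact: measurable_punctured.
have [h|h] := pselect (U (val pole)).
  by rewrite (_ : mkset _ = setT)//; apply/seteqP; split.
by rewrite (_ : mkset _ = set0)//; apply/seteqP; split.
Qed.

Lemma measurable_polar : measurable_fun setT polar.
Proof.
by apply: measurable_fun_pair; [exact: measurable_direction|exact: measurable_enorm].
Qed.

Lemma measurable_polar0 : measurable_fun setT polar0.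
Proof. by apply: measurable_fun_pair => //; exact: measurable_direction. Qed.

End PolarCoordinates.

Section PolarLaw.
Context {R : realType} {n : nat} (mu : probability (borel 'rV[R]_n.+1) R).
Local Open Scope ereal_scope.

Let k : R := fine (mu [set 0%R]).

Lemma measurable_origin : measurable ([set 0%R] : set (borel 'rV[R]_n.+1)).
Proof.
rewrite -setC_punctured; apply: measurableC; exact: measurable_punctured.
Qed.

Let k01 : (0 <= k <= 1)%R.
Proof.
have := measurable_origin => m0.
by rewrite -!lee_fin fineK ?fin_num_measure// measure_ge0 probability_le1.
Qed.

Let atom_ratio : R := (k / (1 - k))%R.

Let atom_ratio_ge0 : (0 <= atom_ratio)%R.
Proof. by case/andP: k01 => k0 k1; rewrite divr_ge0// subr_ge0. Qed.

(* On positive radii, the law of [polar] under [mu]; on the radius 0,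
   k / (1 - k) times the angular marginal of the former. *)
Definition polar_law (A : set (borel (sphere R n) * R)) : \bar R :=
  pushforward (mrestr mu measurable_punctured) polar A +
  (k / (1 - k))%:E * pushforward (mrestr mu measurable_punctured) polar0 A.

Let mu' : {measure set (borel 'rV[R]_n.+1) -> \bar R} :=
  mrestr mu measurable_punctured.

Let push : {measure set (borel (sphere R n) * R) -> \bar R}.
Proof.
refine (pushforward mu' polar : {measure set _ -> \bar R}).
exact: measurable_polar.
Defined.

Let push0 : {measure set (borel (sphere R n) * R) -> \bar R}.
Proof.
refine (pushforward mu' polar0 : {measure set _ -> \bar R}).
exact: measurable_polar0.
Defined.

Let polar_lawE :
  polar_law = measure_add push (mscale (NngNum atom_ratio_ge0) push0).
Proof. by apply/funext => A; rewrite measure_addE. Qed.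

Let polar_law0 : polar_law set0 = 0.
Proof. by rewrite polar_lawE; exact: measure0. Qed.

Let polar_law_ge0 A : 0 <= polar_law A.
Proof. by rewrite polar_lawE; exact: measure_ge0. Qed.

Let polar_law_sigma_additive : semi_sigma_additive polar_law.
Proof. by rewrite polar_lawE; exact: measure_semi_sigma_additive. Qed.

HB.instance Definition _ := isMeasure.Build _ _ _ polar_law
  polar_law0 polar_law_ge0 polar_law_sigma_additive.

Lemma polar_law_setT : mu [set 0%R] < 1 -> polar_law setT = 1.
Proof.
move=> k1; have m0 := measurable_origin.
have kE : mu [set 0%R] = k%:E by rewrite fineK// fin_num_measure.
have muT : mu punctured = (1 - k)%:E.
  by rewrite -[punctured]setCK setC_punctured probability_setC// kE EFinB.
have k1' : (1 - k != 0)%R by rewrite gt_eqF// subr_gt0 -lte_fin -kE.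
rewrite /polar_law /pushforward /mrestr !preimage_setT !setTI.
by rewrite [X in X + _]muT [X in _ * X]muT -EFinM -EFinD divfK// subrK.
Qed.

Definition angular_law : set (borel (sphere R n)) -> \bar R :=
  pushforward polar_law fst.

End PolarLaw.

Section Disintegration.
Context {R : realType} {n : nat} (mu : probability (borel 'rV[R]_n.+1) R).
Local Open Scope ereal_scope.

(* The kernel lives on R; its values are carried by [0, +oo[. *)
Definition is_disintegration (D : R.-pker (borel (sphere R n)) ~> R) : Prop :=
  (forall g, D g `[0%R, +oo[%classic = 1) /\
  (forall (A : set (borel (sphere R n))) (B : set R),
    measurable A -> measurable B ->
    polar_law mu (A `*` B) = \int[angular_law mu]_(g in A) D g B).

Definition radial_mean (D : R.-pker (borel (sphere R n)) ~> R)
    (g : borel (sphere R n)) : \bar R :=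
  \int[D g]_(r in `[0%R, +oo[) r%:E.

End Disintegration.

Section BrownianSemigroups.
Context {R : realType}.
Implicit Types (t r : R) (f : R -> R).

Let p t x y : R := normal_pdf x (Num.sqrt t) y.

(* Brownian motion reflected, resp. killed, at 0, for t > 0: by the reflection
   principle the transition densities on [0, +oo[ are
   p_t(x, y) + p_t(-x, y), resp. p_t(x, y) - p_t(-x, y). *)
Definition reflecting_semigroup t f r : R :=
  \int[lebesgue_measure]_(y in `[0, +oo[) (f y * (p t r y + p t (- r) y)).

Definition killed_semigroup t f r : R :=
  \int[lebesgue_measure]_(y in `[0, +oo[) (f y * (p t r y - p t (- r) y)).

End BrownianSemigroups.

Section WalshSemigroup.
Context {R : realType} {n : nat} (kappa : probability (borel (sphere R n)) R).
Implicit Types (f : 'rV[R]_n.+1 -> R) (z : 'rV[R]_n.+1).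

Definition measure_support : set (sphere R n) :=
  [set g | forall U : set (sphere R n), open U -> U g -> (0 < kappa U)%E].

Definition walsh_space : set 'rV[R]_n.+1 :=
  [set z | exists g r, [/\ measure_support g, 0 <= r & z = r *: val g]].

(* A function on [walsh_space] is represented by any extension of it; the
   topology of [walsh_space] is the Euclidean one. *)
Definition C0 f : Prop :=
  {within walsh_space, continuous f} /\
  forall e, 0 < e -> exists M, forall z,
    walsh_space z -> M < enorm z -> `|f z| < e.

Definition ray_mean f (r : R) : R :=
  \int[kappa]_(g in measure_support) f (r *: val g).

Definition walsh_semigroup (t : R) f z : R :=
  if z == 0 then reflecting_semigroup t (ray_mean f) 0
  else reflecting_semigroup t (ray_mean f) (enorm z) +
    killed_semigroup t
      (fun r => f (r *: val (direction z)) - ray_mean f r) (enorm z).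

End WalshSemigroup.

Section StoppingTimes.
Context {R : realType} {d : measure_display} {Omega : measurableType d}.

(* Times are the nonnegative reals; values at negative indices are ignored. *)
Definition is_filtration (F : R -> set (set Omega)) : Prop :=
  [/\ forall t, 0 <= t -> sigma_algebra setT (F t),
      forall t, 0 <= t -> F t `<=` measurable &
      forall s t, 0 <= s -> s <= t -> F s `<=` F t].

Definition is_stopping_time (F : R -> set (set Omega)) (T : Omega -> \bar R) : Prop :=
  (forall w, (0 <= T w)%E) /\
  (forall t, 0 <= t -> F t [set w | (T w <= t%:E)%E]).

Definition stopped_sigma_algebra (F : R -> set (set Omega)) (T : Omega -> \bar R)
    : set (set Omega) :=
  [set A | measurable A /\
    forall t, 0 <= t -> F t (A `&` [set w | (T w <= t%:E)%E])].

(* [Z 0 w] where [T w] is infinite. *)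
Definition at_time {X : Type} (Z : R -> Omega -> X) (T : Omega -> \bar R)
    (w : Omega) : X := Z (fine (T w)) w.

End StoppingTimes.

Section WalshBrownianMotion.
Context {R : realType} {n : nat} (kappa : probability (borel (sphere R n)) R).
Context {d : measure_display} {Omega : measurableType d}.
Variables (P : probability Omega R) (F : R -> set (set Omega)).
Variable Z : R -> Omega -> 'rV[R]_n.+1.

(* E[f(Z_(T+t)) | F_T] = P_t f(Z_T) almost surely on {T < +oo}, with the
   conditional expectation spelled out by its defining property. *)
Definition strong_markov : Prop :=
  forall (T : Omega -> \bar R) (f : 'rV[R]_n.+1 -> R) (t : R) (A : set Omega),
    is_stopping_time F T -> C0 kappa f -> 0 < t -> stopped_sigma_algebra F T A ->
    \int[P]_(w in A `&` [set w | (T w < +oo)%E])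
      f (Z (fine (T w) + t) w) =
    \int[P]_(w in A `&` [set w | (T w < +oo)%E])
      walsh_semigroup kappa t f (at_time Z T w).

Record is_walsh_brownian_motion : Prop := {
  walsh_filtration : is_filtration F;
  walsh_adapted : forall t (B : set (borel 'rV[R]_n.+1)),
    0 <= t -> measurable B -> F t (Z t @^-1` B);
  walsh_state : forall t w, 0 <= t -> walsh_space kappa (Z t w);
  walsh_continuous : forall w, {within `[0, +oo[, continuous (Z ^~ w)};
  walsh_strong_markov : strong_markov }.

End WalshBrownianMotion.

(* Main.v *)
(* Let |Z| be the radial part, and let phi be continuous and positively
   homogeneous of degree 1 with kappa-mean 0 on the sphere.  The processes
   |Z_t|^2 - t and phi(Z_t) are martingales, so that E |Z_tau|^2 <= E tau and
   E phi(Z_tau) = 0.  Taking phi(z) = |z| (G(z/|z|) - int G dkappa) gives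
   E[|Z_tau| G(Z_tau/|Z_tau|)] = E|Z_tau| int G dkappa for every continuous G,
   hence for indicators of Borel sets, which is the claim once the left-hand
   side is disintegrated.
   As the Markov property only covers functions vanishing at infinity, the
   martingales are replaced by space-time ones built from Gaussians: with q_v the
   centred Gaussian density of variance v, the semigroup maps q_v(|z|) to
   q_(v+t)(|z|) and phi(z)/v q_v(|z|) to phi(z)/(v+t) q_(v+t)(|z|).  Optional
   stopping is used for tau rounded up to a grid and capped, a stopping time with
   finitely many values; then the mesh tends to 0 while the cap and v tend to
   infinity. *)
Require Import Defs.
From HB Require Import structures.
From mathcomp Require Import all_boot all_order all_algebra.
From mathcomp Require Import all_classical all_reals all_analysis.
From mathcomp Require Import measurable_realfun.
From mathcomp Require Import ring lra.

Set Implicit Arguments.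
Unset Strict Implicit.
Unset Printing Implicit Defensive.

Import Order.TTheory GRing.Theory Num.Theory.
Import numFieldNormedType.Exports.

Local Open Scope classical_set_scope.
Local Open Scope ring_scope.

(** * Gaussian kernels and the half-line semigroups *)

(** A space-time function must lose variance as time advances: on a grid of [N] steps of size [h]
    the variance at step [j] is [v + (N - j) h], and one application of the semigroup restores the
    variance of the preceding step. Multiplied by [V sqrt(2 pi V)], with [V] the final variance, the
    profile of [phi] tends to [phi] provided [V] outgrows the horizon; hence mesh [1/(k+1)], horizon
    [k+1] and [V = (k+1)^2]. For the square only an inequality is proved. The function
    [2v (1 - sqrt(2 pi v) q_v(y))] lies above a truncation of [y^2], and after a time [h] the
    semigroup has turned it into a function below [y^2 + h]. Hence [E |Z_(s+h)|^2 <= E |Z_s|^2 + h]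
    on every event of [F s]. The resulting L^2 bound is uniform in [k] and serves twice: through
    Fatou for the second moment, and as uniform integrability when the mean of [phi] passes to the
    limit. Stopping happens on a grid, so the Markov property enters at constant times only. *)

Section GaussianKernels.
Context {R : realType}.
Implicit Types (m s t v r y : R).
Local Notation leb := (@lebesgue_measure R).

Lemma normal_pdf_sqrtE m v y : 0 < v ->
  normal_pdf m (Num.sqrt v) y =
  (Num.sqrt (v * pi *+ 2))^-1 * expR (- (y - m) ^+ 2 / (v *+ 2)).
Proof.
move=> v0; rewrite normal_pdfE ?gt_eqF ?sqrtr_gt0//.
by rewrite /normal_peak /normal_fun sqr_sqrtr// ltW.
Qed.

(** Completing the square in [y]: if two independent centred Gaussians of variances [v] and [t] have
    sum [r], the first is Gaussian with mean [r v / (v + t)] and variance [v t / (v + t)]. This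
    reduces the semigroup integrals to half-line integrals of a single Gaussian. *)
Lemma normal_pdf_mul v t r y : 0 < v -> 0 < t ->
  normal_pdf 0 (Num.sqrt v) y * normal_pdf r (Num.sqrt t) y =
  normal_pdf 0 (Num.sqrt (v + t)) r *
  normal_pdf (r * (v / (v + t))) (Num.sqrt (v * t / (v + t))) y.
Proof.
move=> v0 t0; have vt0 : 0 < v + t by rewrite addr_gt0.
have s0 : 0 < v * t / (v + t) by rewrite divr_gt0// mulr_gt0.
rewrite !normal_pdf_sqrtE// mulrACA -expRD [RHS]mulrACA -expRD.
have p0 : 0 < pi :> R by exact: pi_gt0.
congr (_ * expR _).
  rewrite -!invfM -!sqrtrM ?mulrn_wge0 ?mulr_ge0 ?(ltW p0) ?(ltW v0) ?(ltW vt0)//.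
  congr (Num.sqrt _)^-1; field.
  by rewrite gt_eqF.
by field; rewrite !gt_eqF.
Qed.

Lemma normal_pdf_opp m s y : s != 0 -> normal_pdf (- m) s y = normal_pdf m s (- y).
Proof.
move=> s0; rewrite (normal_pdfE (- m))// (normal_pdfE m)// /normal_fun.
by have -> : (y - - m) ^+ 2 = (- y - m) ^+ 2 by ring.
Qed.

(** The reflection [y -> -y] identifies the second integral with the mass that the first density
    puts on the negative half-line. *)
Lemma integral_normal_pdf_half m s : 0 < s ->
  (\int[leb]_(y in `[0%R, +oo[) (normal_pdf m s y)%:E +
   \int[leb]_(y in `[0%R, +oo[) (normal_pdf (- m) s y)%:E = 1)%E.
Proof.
move=> s0; rewrite -(integral_normal_pdf m s).
have mq (A : set R) : measurable_fun A (fun y => (normal_pdf m s y)%:E).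
  by apply: measurable_funTS; apply/measurable_EFinP; exact: measurable_normal_pdf.
have -> : [set: R] = `[0%R, +oo[ `|` `]-oo, 0%R[ by rewrite -setCitvr setUv.
have q0 (A : set R) y : A y -> (0 <= (normal_pdf m s y)%:E)%E.
  by move=> _; rewrite lee_fin normal_pdf_ge0.
have dj : [disjoint `[0%R, +oo[ & `]-oo, (0 : R)[]%classic.
  by rewrite -setCitvr; exact/disj_setPCl.
have -> := ge0_integral_setU leb (measurable_itv `[0%R, +oo[)
  (measurable_itv `]-oo, 0%R[) (mq _) (q0 _) dj.
congr (_ + _)%E.
rewrite (integral_itv_bndo_bndc (mq _)).
have -> : `]-oo, 0%R]%classic = `]-oo, (- 0)%R]%classic :> set R by rewrite oppr0.
rewrite ge0_integration_by_substitutionNy.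
- by apply: eq_integral => y _; rewrite normal_pdf_opp// gt_eqF.
- by apply: continuous_subspaceT; apply: continuous_normal_pdf; rewrite gt_eqF.
- by move=> y _; exact: normal_pdf_ge0.
Qed.

Lemma integrable_setU d (T : measurableType d) (mu : {measure set T -> \bar R})
    (A B : set T) (f : T -> \bar R) :
  measurable A -> measurable B -> [disjoint A & B] ->
  mu.-integrable A f -> mu.-integrable B f -> mu.-integrable (A `|` B) f.
Proof.
move=> mA mB AB /integrableP[mfA fA] /integrableP[mfB fB].
have mf : measurable_fun (A `|` B) f by apply/measurable_funU.
apply/integrableP; split => //.
have := ge0_integral_setU mu mA mB _ (fun x _ => abse_ge0 (f x)) AB.
by move=> ->; [rewrite lte_add_pinfty|exact: measurableT_comp].
Qed.

Lemma is_derive_normal_pdf m s y : s != 0 ->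
  is_derive y 1 (fun x => - s ^+ 2 * normal_pdf m s x) ((y - m) * normal_pdf m s y).
Proof.
move=> s0; rewrite (normal_pdfE m)// /normal_fun.
have d : is_derive y 1 (fun x : R => - (x - m) ^+ 2 / (s ^+ 2 *+ 2))
    (- (y - m) / s ^+ 2).
  rewrite (_ : (fun x => _) = (fun x => - (s ^+ 2 *+ 2)^-1 * (x - m) ^+ 2)); last first.
    by apply/funext => x; rewrite mulNr mulrC mulNr.
  apply: is_derive_eq; rewrite /GRing.scale/=; field.
  exact: s0.
apply: is_derive_eq; rewrite /GRing.scale/=; field.
exact: s0.
Qed.

Lemma cvgy_normal_pdf m s : 0 < s -> normal_pdf m s y @[y --> +oo] --> (0 : R).
Proof.
move=> s0; rewrite (normal_pdfE m) ?gt_eqF// /normal_fun.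
rewrite -[X in _ --> X](mulr0 (normal_peak s)); apply: cvgMr.
have c : (y - m) ^+ 2 / (s ^+ 2 *+ 2) @[y --> +oo] --> +oo.
  apply: gt0_cvgMly; first by rewrite invr_gt0 mulrn_wgt0// exprn_gt0.
  apply: (cvg_comp (fun y => y - m) (fun x => x ^+ 2)); last exact: cvgr_expr2.
  exact: cvg_addrr.
under eq_fun do rewrite mulNr.
exact: cvg_comp c (@cvgr_expR R).
Qed.

(** Write [y = m + (y - m)]; the second part times the density has the primitive [- s^2] times the
    density, which leaves only the boundary term at 0. *)
Lemma half_line_normal_mean m s : 0 < s ->
  leb.-integrable `[0, +oo[ (fun y => (y * normal_pdf m s y)%:E) /\
  \int[leb]_(y in `[0, +oo[) (y * normal_pdf m s y) =
    m * \int[leb]_(y in `[0, +oo[) normal_pdf m s y + s ^+ 2 * normal_pdf m s 0.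
Proof.
move=> s0; have sn0 : s != 0 by rewrite gt_eqF.
pose f (y : R) : R := (y - m) * normal_pdf m s y.
pose F (y : R) : R := - s ^+ 2 * normal_pdf m s y.
(* Cutting to the right of [m] makes [f] nonnegative on the unbounded piece, as the fundamental
   theorem up to infinity requires; the remaining piece is compact. *)
pose A : R := `|m| + 1.
have A0 : 0 < A by rewrite ltr_pwDr.
have cf : continuous f.
  move=> y; apply: cvgM; last exact: continuous_normal_pdf.
  by apply: (@cvgB _ R^o) => //; exact: cvg_cst.
have cF : continuous F.
  by move=> y; apply: cvgM; [exact: cvg_cst|exact: continuous_normal_pdf].
have dF y : derivable F y 1 by have [] := is_derive_normal_pdf m y sn0.
have F'E y : (F^`()%classic) y = f y.
  by rewrite derive1E; have [_] := is_derive_normal_pdf m y sn0.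
have mf (D : set R) : measurable_fun D (EFin \o f).
  by apply: measurable_funTS; apply/measurable_EFinP; exact: continuous_measurable_fun.
have I1 : (\int[leb]_(y in `[0%R, A]) (f y)%:E = (F A)%:E - (F 0)%:E)%E.
  apply: continuous_FTC2 => //; first exact: continuous_subspaceT.
  by split=> //; [apply: cvg_at_right_filter|apply: cvg_at_left_filter]; exact: cF.
have f0 y : A <= y -> 0 <= f y.
  move=> Ay; rewrite mulr_ge0 ?normal_pdf_ge0// subr_ge0 (le_trans _ Ay)//.
  by rewrite /A (le_trans (ler_norm m))// lerDl.
have I2 : (\int[leb]_(y in `[A, +oo[) (f y)%:E = 0%:E - (F A)%:E)%E.
  apply: ge0_continuous_FTC2y => //; first exact: continuous_subspaceT.
    rewrite -[X in _ --> X](mulr0 (- s ^+ 2)); apply: cvgMr.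
    exact: cvgy_normal_pdf.
  by apply: cvg_at_right_filter; exact: cF.
have i1 : leb.-integrable `[0, A] (EFin \o f).
  apply: continuous_compact_integrable; first exact: segment_compact.
  exact: continuous_subspaceT.
have i2' : leb.-integrable `[A, +oo[ (EFin \o f).
  apply/integrableP; split; first exact: mf.
  have -> : (\int[leb]_(y in `[A, +oo[) `|(EFin \o f) y| =
             \int[leb]_(y in `[A, +oo[) (f y)%:E)%E.
    apply: eq_integral => y; rewrite inE/= in_itv/= andbT => Ay.
    by rewrite ger0_norm// f0.
  by rewrite I2 -EFinB ltry.
have i2 : leb.-integrable `]A, +oo[ (EFin \o f).
  by apply: integrableS i2' => //; apply: subset_itvr; rewrite bnd_simp.
have E : `[0, +oo[%classic = `[0, A] `|` `]A, +oo[ :> set R.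
  by rewrite -itv_bndbnd_setU// bnd_simp ltW.
have dj : [disjoint `[0, A] & `]A, +oo[ : set R].
  apply/disj_setPS => y [/=]; rewrite 2!in_itv/= andbT => /andP[_ yA].
  by rewrite ltNge yA.
have i3 : leb.-integrable `[0, +oo[ (EFin \o f).
  by rewrite E; apply: integrable_setU.
have i4 : leb.-integrable `[0, +oo[ (EFin \o normal_pdf m s).
  by apply: integrableS (integrable_normal_pdf m s).
have I3 : \int[leb]_(y in `[0, +oo[) f y = s ^+ 2 * normal_pdf m s 0.
  rewrite {1}E Rintegral_setU//; last by rewrite -E.
  rewrite /Rintegral I1 (integral_itv_obnd_cbnd (mf _)) I2/= /F; ring.
have i5 : leb.-integrable `[0, +oo[ (fun y => m%:E * (normal_pdf m s y)%:E)%E.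
  exact: (@integrableZl _ _ R leb).
have fE : (fun y => y * normal_pdf m s y) = (fun y => m * normal_pdf m s y + f y).
  by apply/funext => y; rewrite /f; ring.
split.
  have -> : (fun y => (y * normal_pdf m s y)%:E) =
            (fun y => (m * normal_pdf m s y)%:E + (f y)%:E)%E.
    by apply/funext => y; rewrite -EFinD; congr EFin; have := congr1 (@^~ y) fE.
  exact: integrableD.
by rewrite fE RintegralD// RintegralZl// I3.
Qed.

End GaussianKernels.

Section Semigroups.
Context {R : realType}.
Implicit Types (t v r y c : R) (f g : R -> R).
Local Notation leb := (@lebesgue_measure R).

Lemma eq_reflecting_semigroup t f g r : (forall y, 0 <= y -> f y = g y) ->
  reflecting_semigroup t f r = reflecting_semigroup t g r.
Proof.
by move=> fg; apply: eq_Rintegral => y; rewrite inE/= in_itv/= andbT => /fg ->.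
Qed.

Lemma eq_killed_semigroup t f g r : (forall y, 0 <= y -> f y = g y) ->
  killed_semigroup t f r = killed_semigroup t g r.
Proof.
by move=> fg; apply: eq_Rintegral => y; rewrite inE/= in_itv/= andbT => /fg ->.
Qed.

Lemma reflecting_semigroup0 t r : reflecting_semigroup t (cst 0) r = 0.
Proof.
rewrite /reflecting_semigroup/=; under eq_Rintegral do rewrite mul0r.
by rewrite /Rintegral integral0.
Qed.

Lemma killed_semigroup0 t r : killed_semigroup t (cst 0) r = 0.
Proof.
rewrite /killed_semigroup/=; under eq_Rintegral do rewrite mul0r.
by rewrite /Rintegral integral0.
Qed.

Lemma Rintegral_normal_pdf_half m s : 0 < s ->
  \int[leb]_(y in `[0, +oo[) normal_pdf m s y +
  \int[leb]_(y in `[0, +oo[) normal_pdf (- m) s y = 1.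
Proof.
move=> s0; have := integral_normal_pdf_half m s0.
have fin k : (\int[leb]_(y in `[0%R, +oo[) (normal_pdf k s y)%:E)%E \is a fin_num.
  apply: (@integrable_fin_num _ _ _ leb) => //.
  by apply: integrableS (integrable_normal_pdf k s).
by move=> /(congr1 fine); rewrite fineD.
Qed.

(** The starting points [r] and [- r] produce the same Gaussian factor, and the two conditional
    Gaussians have opposite means, so their masses on the half-line add up to 1. *)
Lemma reflecting_semigroup_normal v t r : 0 < v -> 0 < t ->
  reflecting_semigroup t (normal_pdf 0 (Num.sqrt v)) r =
  normal_pdf 0 (Num.sqrt (v + t)) r.
Proof.
move=> v0 t0; rewrite /reflecting_semigroup.
set s := Num.sqrt (v * t / (v + t)); set a := v / (v + t).
have s0 : 0 < s by rewrite sqrtr_gt0 divr_gt0 ?mulr_gt0 ?addr_gt0.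
have i k : leb.-integrable `[0, +oo[ (EFin \o normal_pdf k s).
  by apply: integrableS (integrable_normal_pdf k s).
set C := RHS.
have CN : normal_pdf 0 (Num.sqrt (v + t)) (- r) = C.
  by rewrite -normal_pdf_opp ?oppr0// gt_eqF// sqrtr_gt0 addr_gt0.
transitivity (\int[leb]_(y in `[0, +oo[)
    (C * (normal_pdf (r * a) s y + normal_pdf (- (r * a)) s y))).
  apply: eq_Rintegral => y _; rewrite mulrDr (normal_pdf_mul r y v0 t0) (normal_pdf_mul (- r) y v0 t0) CN -mulNr.
  by rewrite -mulrDr.
rewrite RintegralZl//; last first.
  exact: (@integrableD _ _ _ leb _ _ _ _ (i _) (i _)).
by rewrite RintegralD// Rintegral_normal_pdf_half// mulr1.
Qed.

(** [y / v] times the centred density is minus its derivative, an odd function, on which killing at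
    0 acts like the heat flow. In the computation the boundary terms of the two half-line means
    coincide and cancel, and the masses again add up to 1. *)
Lemma killed_semigroup_normal v t r c : 0 < v -> 0 < t ->
  killed_semigroup t (fun y => c * (y / v * normal_pdf 0 (Num.sqrt v) y)) r =
  c * (r / (v + t) * normal_pdf 0 (Num.sqrt (v + t)) r).
Proof.
move=> v0 t0; rewrite /killed_semigroup.
set s := Num.sqrt (v * t / (v + t)); set a := v / (v + t).
have s0 : 0 < s by rewrite sqrtr_gt0 divr_gt0 ?mulr_gt0 ?addr_gt0.
have i k : leb.-integrable `[0, +oo[ (EFin \o (fun y => y * normal_pdf k s y)).
  exact: (half_line_normal_mean k s0).1.
set C := normal_pdf 0 (Num.sqrt (v + t)) r.
have CN : normal_pdf 0 (Num.sqrt (v + t)) (- r) = C.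
  by rewrite -normal_pdf_opp ?oppr0// gt_eqF// sqrtr_gt0 addr_gt0.
transitivity (\int[leb]_(y in `[0, +oo[)
    (c * (C / v) * (y * normal_pdf (r * a) s y - y * normal_pdf (- (r * a)) s y))).
  apply: eq_Rintegral => y _.
  have E k := normal_pdf_mul k y v0 t0.
  transitivity (c * (y / v) * (normal_pdf 0 (Num.sqrt v) y * normal_pdf r (Num.sqrt t) y
     - normal_pdf 0 (Num.sqrt v) y * normal_pdf (- r) (Num.sqrt t) y)); first by ring.
  by rewrite !E CN -/C mulNr -/s -/a; ring.
rewrite RintegralZl//; last first.
  exact: (@integrableB _ _ _ leb _ _ _ _ (i _) (i _)).
rewrite RintegralB//.
have M k := (half_line_normal_mean k s0).2.
rewrite (M (r * a)) (M (- (r * a))).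
rewrite normal_pdf_opp ?oppr0 ?gt_eqF//.
have /(congr1 (fun z => z - \int[leb]_(y in `[0, +oo[) normal_pdf (- (r * a)) s y)) :=
  Rintegral_normal_pdf_half (r * a) s0.
rewrite addrK => ->; rewrite /a; field.
by rewrite !gt_eqF// addr_gt0.
Qed.

End Semigroups.

(** * The Walsh semigroup on Gaussian test functions *)

Section Support.
Context {R : realType} {n : nat} (kappa : probability (borel (sphere R n)) R).
Implicit Types (g : sphere R n).

Lemma open_sphereP (U : set (sphere R n)) :
  open U <-> exists2 V : set 'rV[R]_n.+1, open V & set_val @^-1` V = U.
Proof. by []. Qed.

(** Needed because [ray_mean] integrates over the support only. A point off the support has a null
    open neighbourhood; each of these contains a null cell around the point taken from a countable
    family with rational centres, and the union of all null cells is null. *)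
Lemma measure_support_negligible : exists2 N : set (borel (sphere R n)),
  open N & ~` measure_support kappa = N /\ kappa N = 0%E.
Proof.
pose cell (i : 'rV[rat]_n.+1 * nat) : set (sphere R n) :=
  set_val @^-1` (interior (ball (map_mx ratr i.1 : 'rV[R]_n.+1) i.2.+1%:R^-1)).
have ocell i : open (cell i).
  by apply/open_sphereP; exists (interior (ball (map_mx ratr i.1 : 'rV[R]_n.+1) i.2.+1%:R^-1)) => //; exact: open_interior.
have mop (U : set (sphere R n)) : open U -> measurable (U : set (borel (sphere R n))).
  exact: sub_sigma_algebra.
pose N k := if unpickle k is Some i then if kappa (cell i) == 0%E then cell i else set0
  else set0.
have oN k : open (N k).
  by rewrite /N; case: unpickle => [i|]; [case: ifP|] => // *; exact: open0.
have N0 k : kappa (N k) = 0%E.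
  rewrite /N; case: unpickle => [i|]; last exact: measure0.
  by case: ifP => [/eqP//|_]; exact: measure0.
exists (\bigcup_k N k); first exact: bigcup_open.
split.
  apply/seteqP; split=> [g /= /existsNP[U /not_implyP[oU /not_implyP[Ug /negP kU]]]|g [k _ Nkg] /(_ _ (oN k) Nkg)].
    have kU0 : kappa U = 0%E.
      apply/eqP; rewrite eq_le measure_ge0 andbT.
      by rewrite leNgt.
    have [V oV VU] : exists2 V, open V & set_val @^-1` V = U by exact/open_sphereP.
    have : nbhs (set_val g) V by apply: open_nbhs_nbhs; split => //; rewrite -VU in Ug.
    move=> /nbhs_ballP[e /= e0 geV].
    (* With a rational centre within [1/(2(k+1))] of [g], the cell of radius [1/(k+1)] has [g] in
       its interior and stays within [3/(2(k+1)) < e] of [g]. *)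
    have [k ke] : exists k : nat, 2 * k.+1%:R^-1 < e.
      have [k _ /(_ k (leqnn _))] := near_infty_natSinv_lt (PosNum (divr_gt0 e0 (ltr0Sn R 1))).
      by exists k; rewrite mulrC -ltr_pdivlMr.
    have k0 : 0 < k.+1%:R^-1 :> R by rewrite invr_gt0.
    have qE (i : 'I_n.+1) : exists q : rat, `|ratr q - set_val g ord0 i| < k.+1%:R^-1 / 2.
      have /rat_in_itvoo[q] : set_val g ord0 i - k.+1%:R^-1 / 2 < set_val g ord0 i + k.+1%:R^-1 / 2.
        by rewrite ltrD2l gtrN// divr_gt0.
      by rewrite in_itv/= => qi; exists q; rewrite ltr_distl.
    pose q : 'rV[rat]_n.+1 := \row_i sval (cid (qE i)).
    have qg : ball (map_mx ratr q : 'rV[R]_n.+1) (k.+1%:R^-1 / 2) (set_val g).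
      split=> [|i j]; first by rewrite divr_gt0.
      rewrite !mxE (ord1 i) /ball/=.
      by case: cid.
    have cg : cell (q, k) g.
      apply: (@filterS _ _ _ (ball (set_val g) (k.+1%:R^-1 / 2))).
        move=> z gz; have := ball_triangle qg gz; rewrite -splitr; exact.
      by apply: nbhsx_ballx; rewrite divr_gt0.
    have cU : cell (q, k) `<=` U.
      move=> x /interior_subset/= qx; rewrite -VU; apply: geV.
      apply: (@le_ball _ _ _ (k.+1%:R^-1 / 2 + k.+1%:R^-1)).
        apply: le_trans (ltW ke); rewrite mulr_natl mulr2n lerD2r.
        by rewrite ler_pdivrMr// ler_pMr// (ler1n _ 2).
      by apply: ball_triangle qx; exact: ball_sym.
    exists (pickle (q, k)) => //; rewrite /N pickleK.
    rewrite (_ : kappa _ = 0%E) ?eqxx//.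
    apply/eqP; rewrite eq_le measure_ge0 andbT -kU0.
    by apply: le_measure => //; rewrite inE; apply: mop.
  by rewrite N0 ltxx.
apply/measure_negligible.
  by apply: bigcup_measurable => k _; exact: mop (oN k).
by apply: negligible_bigcup => k; apply/negligibleP; [exact: mop (oN k)|exact: N0].
Qed.

Lemma measurable_measure_support :
  measurable (measure_support kappa : set (borel (sphere R n))).
Proof.
have [N oN [supN _]] := measure_support_negligible.
by rewrite -[measure_support _]setCK supN; apply: measurableC; exact: sub_sigma_algebra.
Qed.

Lemma measure_support1 : kappa (measure_support kappa) = 1%E.
Proof.
have [N oN [supN N0]] := measure_support_negligible.
rewrite -[measure_support _]setCK supN probability_setC//.
  by rewrite N0 sube0.
exact: sub_sigma_algebra.
Qed.

End Support.

Section WalshTestFunctions.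
Context {R : realType} {n : nat} (kappa : probability (borel (sphere R n)) R).
Implicit Types (z : 'rV[R]_n.+1) (v t : R) (phi : 'rV[R]_n.+1 -> R).

Definition pos_homogeneous phi := forall (r : R) z, 0 <= r -> phi (r *: z) = r * phi z.

Lemma enorm_sphere (g : sphere R n) : enorm (val g) = 1.
Proof. by have := valP g; rewrite inE. Qed.

Lemma enorm_direction z : enorm z *: val (direction z) = z.
Proof.
have [->|z0] := eqVneq z 0; first by rewrite enorm0 scale0r.
by rewrite val_direction// scalerA divff ?scale1r// enorm_eq0.
Qed.

(** A radial function agrees with its ray mean at nonnegative radii, so the killed term vanishes and
    the reflecting semigroup acts alone. *)
Lemma walsh_semigroup_radial v t z : 0 < v -> 0 < t ->
  walsh_semigroup kappa t (fun z => normal_pdf 0 (Num.sqrt v) (enorm z)) z =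
  normal_pdf 0 (Num.sqrt (v + t)) (enorm z).
Proof.
move=> v0 t0.
have E (g : sphere R n) y : 0 <= y -> enorm (y *: val g) = y.
  by move=> y0; rewrite enormZ enorm_sphere mulr1 ger0_norm.
have M y : 0 <= y -> ray_mean kappa (fun z => normal_pdf 0 (Num.sqrt v) (enorm z)) y =
    normal_pdf 0 (Num.sqrt v) y.
  move=> y0; rewrite /ray_mean; under eq_Rintegral do rewrite E//.
  rewrite Rintegral_cst; last exact: measurable_measure_support.
  by rewrite [X in fine X]measure_support1 mulr1.
rewrite /walsh_semigroup !(eq_reflecting_semigroup _ _ M) !reflecting_semigroup_normal//.
case: eqVneq => [->|z0]; first by rewrite enorm0.
rewrite (@eq_killed_semigroup _ _ _ (cst 0)) ?killed_semigroup0 ?addr0// => y y0.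
by rewrite E// M// subrr.
Qed.

(** The opposite extreme: mean zero on the sphere makes the ray mean vanish at every radius, so only
    the killed term survives, and along a ray the function is a constant times [y / v] times the
    density. At the vertex both sides are 0, since homogeneity with [r = 0] gives [phi 0 = 0]. *)
Lemma walsh_semigroup_homogeneous phi v t z : 0 < v -> 0 < t ->
  pos_homogeneous phi ->
  kappa.-integrable (measure_support kappa) (EFin \o (phi \o val)) ->
  \int[kappa]_(g in measure_support kappa) phi (val g) = 0 ->
  walsh_semigroup kappa t
    (fun z => phi z / v * normal_pdf 0 (Num.sqrt v) (enorm z)) z =
  phi z / (v + t) * normal_pdf 0 (Num.sqrt (v + t)) (enorm z).
Proof.
move=> v0 t0 hphi iphi phi0.
have E (g : sphere R n) y : 0 <= y -> enorm (y *: val g) = y.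
  by move=> y0; rewrite enormZ enorm_sphere mulr1 ger0_norm.
have M y : 0 <= y -> ray_mean kappa
    (fun z => phi z / v * normal_pdf 0 (Num.sqrt v) (enorm z)) y = (cst 0 : R -> R) y.
  move=> y0; rewrite /ray_mean.
  transitivity (\int[kappa]_(g in measure_support kappa)
      ((y / v * normal_pdf 0 (Num.sqrt v) y) * phi (val g))).
    by apply: eq_Rintegral => g _; rewrite hphi// E//; ring.
  by rewrite RintegralZl//; [rewrite phi0 mulr0|exact: measurable_measure_support].
rewrite /walsh_semigroup !(eq_reflecting_semigroup _ _ M) !reflecting_semigroup0.
case: eqVneq => [->|z0].
  by rewrite -[X in phi X](scale0r 0) hphi// !mul0r.
rewrite add0r (@eq_killed_semigroup _ _ _ (fun y => phi (val (direction z)) *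
    (y / v * normal_pdf 0 (Num.sqrt v) y))); last first.
  by move=> y y0; rewrite M// subr0 hphi// E//; ring.
rewrite killed_semigroup_normal// -[in RHS](enorm_direction z) hphi ?enorm_ge0//.
by rewrite enorm_direction; ring.
Qed.

(** From [1 + x <= exp x] at [x = y^2 / (2 v)]. Quadratic decay absorbs the linear growth of [phi]
    and still leaves a function vanishing at infinity. *)
Lemma normal_pdf0_decay v (y : R) : 0 < v ->
  y ^+ 2 * normal_pdf 0 (Num.sqrt v) y <= (Num.sqrt (v * pi *+ 2))^-1 * (v *+ 2).
Proof.
move=> v0; rewrite normal_pdf_sqrtE// mulrCA ler_wpM2l ?invr_ge0//.
rewrite subr0 mulNr expRN ler_pdivrMr ?expR_gt0//.
apply: le_trans (_ : (v *+ 2) * (1 + y ^+ 2 / (v *+ 2)) <= _).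
  rewrite mulrDr mulr1 mulrC divfK; last by rewrite gt_eqF// mulrn_wgt0.
  by rewrite lerDr mulrn_wge0// ltW.
by rewrite ler_wpM2l ?expR_ge1Dx// mulrn_wge0// ltW.
Qed.

Lemma continuous_normal_pdf_enorm v : 0 < v ->
  continuous (fun z => normal_pdf 0 (Num.sqrt v) (enorm z)).
Proof.
move=> v0 z; apply: (@continuous_comp _ _ _ (@enorm R n)); first exact: enorm_continuous.
by apply: continuous_normal_pdf; rewrite gt_eqF// sqrtr_gt0.
Qed.

Lemma C0_radial v : 0 < v ->
  C0 kappa (fun z => normal_pdf 0 (Num.sqrt v) (enorm z)).
Proof.
move=> v0; split; first exact/continuous_subspaceT/continuous_normal_pdf_enorm.
move=> e e0; set K := (Num.sqrt (v * pi *+ 2))^-1 * (v *+ 2).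
(* Beyond this radius [y > 1] and [K < e y], so [y^2 q <= K] forces [q < e]. *)
exists (1 + K / e) => z _ Mz.
have K0 : 0 <= K by rewrite mulr_ge0 ?invr_ge0 ?sqrtr_ge0// mulrn_wge0// ltW.
have y1 : 1 < enorm z by apply: le_lt_trans Mz; rewrite lerDl divr_ge0// ltW.
have := normal_pdf0_decay (enorm z) v0; rewrite -/K => H.
have q0 := normal_pdf_ge0 0 (Num.sqrt v) (enorm z).
rewrite ger0_norm//; have : K < e * enorm z.
  by rewrite -ltr_pdivrMl// mulrC; apply: le_lt_trans Mz; rewrite lerDr.
nra.
Qed.

Lemma C0_homogeneous phi v C : 0 < v -> continuous phi ->
  (forall z, `|phi z| <= C * enorm z) ->
  C0 kappa (fun z => phi z / v * normal_pdf 0 (Num.sqrt v) (enorm z)).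
Proof.
move=> v0 cphi bphi; split.
  have c1 : continuous (fun z => phi z / v).
    by move=> z; apply: (@continuousM R _ phi (cst v^-1)); [exact: cphi|exact: cst_continuous].
  apply: continuous_subspaceT => z.
  exact: (@continuousM R _ _ _ z (c1 z) (@continuous_normal_pdf_enorm v v0 z)).
move=> e e0; set K := (Num.sqrt (v * pi *+ 2))^-1 * (v *+ 2).
pose L := `|C| * v^-1 * K.
exists (1 + L / e) => z _ Mz.
have K0 : 0 <= K by rewrite mulr_ge0 ?invr_ge0 ?sqrtr_ge0// mulrn_wge0// ltW.
have v1 : 0 < v^-1 by rewrite invr_gt0.
have v1' := ltW v1; have L0 : 0 <= L by exact: mulr_ge0 (mulr_ge0 (normr_ge0 C) v1') K0.
have y1 : 1 < enorm z by apply: le_lt_trans Mz; rewrite lerDl divr_ge0// ltW.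
have := normal_pdf0_decay (enorm z) v0; rewrite -/K => H.
have q0 := normal_pdf_ge0 0 (Num.sqrt v) (enorm z).
have Le : L < e * enorm z.
  by rewrite -ltr_pdivrMl// mulrC; apply: le_lt_trans Mz; rewrite lerDr.
have y0 : 0 < enorm z by apply: lt_trans y1.
rewrite -(ltr_pM2r y0); apply: le_lt_trans Le.
rewrite !normrM (ger0_norm q0) (gtr0_norm v1) /L.
apply: (@le_trans _ _ (`|C| * v^-1 * (enorm z ^+ 2 * normal_pdf 0 (Num.sqrt v) (enorm z)))).
  have bz : `|phi z| <= `|C| * enorm z.
    by apply: le_trans (bphi z) _; rewrite ler_wpM2r ?enorm_ge0// ler_norm.
  have := ler_wpM2r (mulr_ge0 v1' (mulr_ge0 q0 (ltW y0))) bz.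
  by congr (_ <= _); ring.
by apply: ler_wpM2l => //; exact: mulr_ge0 (normr_ge0 C) v1'.
Qed.

End WalshTestFunctions.

(** * Passing to the limit under an L^2 bound *)

Section UniformIntegrability.
Context {R : realType} d (T : measurableType d) (P : probability T R).
Implicit Types (X : T -> R).

Lemma bounded_integrable_prob (A : set T) X (C : R) : measurable A ->
  measurable_fun A X -> (forall w, A w -> `|X w| <= C) ->
  P.-integrable A (EFin \o X).
Proof.
move=> mA mX XC; apply: measurable_bounded_integrable => //.
  by rewrite (le_lt_trans (probability_le1 _ _))// ltry.
exists C; split; first exact: num_real.
by move=> M CM w Aw; exact: le_trans (XC w Aw) (ltW CM).
Qed.

Lemma square_integrable_integrable X (M : R) : measurable_fun setT X ->
  (\int[P]_w ((X w) ^+ 2)%:E <= M%:E)%E -> P.-integrable setT (EFin \o X).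
Proof.
move=> mX XM; have mX2 : measurable_fun setT (fun w => (X w ^+ 2)%:E).
  by apply/measurable_EFinP; apply: measurable_funX.
apply: (@le_integrable _ _ _ _ _ _ _ (fun w => (1 + X w ^+ 2)%:E)) => //.
- exact/measurable_EFinP.
- move=> w _; rewrite /= lee_fin [leRHS]ger0_norm; last by rewrite addr_ge0// sqr_ge0.
  by have := real_normK (num_real (X w)); have := normr_ge0 (X w); nra.
apply/integrableP; split.
  by apply/measurable_EFinP; apply: measurable_funD => //; exact/measurable_EFinP.
under eq_integral do rewrite /= ger0_norm ?addr_ge0 ?sqr_ge0// EFinD.
rewrite ge0_integralD//; last by move=> w _; rewrite lee_fin sqr_ge0.
rewrite integral_cst// mul1e lte_add_pinfty//.
  by rewrite (le_lt_trans (probability_le1 _ _))// ltry.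
exact: le_lt_trans XM (ltry _).
Qed.

(** The limit inferior of the squares is [X^2] only almost everywhere, since the discretized
    variables are controlled only where [tau] is finite; hence the comparison of integrals almost
    everywhere before Fatou. *)
Lemma fatou_square (Y : nat -> T -> R) X (M : R) :
  (forall k, measurable_fun setT (Y k)) -> measurable_fun setT X ->
  {ae P, forall w, Y k w @[k --> \oo] --> X w} ->
  (forall k, (\int[P]_w ((Y k w) ^+ 2)%:E <= M%:E)%E) ->
  (\int[P]_w ((X w) ^+ 2)%:E <= M%:E)%E.
Proof.
move=> mY mX YX YM.
have mY2 k : measurable_fun setT (fun w => (Y k w ^+ 2)%:E).
  by apply/measurable_EFinP; apply: measurable_funX.
have F := @fatou _ _ R P setT measurableT (fun k w => (Y k w ^+ 2)%:E) mY2
  (fun k w _ => (sqr_ge0 (Y k w))).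
apply: (@le_trans _ _ (limn_einf (fun k => \int[P]_w (Y k w ^+ 2)%:E)%E)); last first.
  rewrite limn_einf_lim; apply: lime_le.
    apply: ereal_nondecreasing_is_cvgn; exact: nondecreasing_einfs.
  apply: nearW => k; apply: le_trans (YM k).
  by apply: ereal_inf_lbound; exists k => //=.
apply: le_trans F; apply: ae_ge0_le_integral => //.
- by move=> w _; rewrite lee_fin sqr_ge0.
- by apply/measurable_EFinP; apply: measurable_funX.
- move=> w _; rewrite limn_einf_lim; apply: lime_ge.
    apply: ereal_nondecreasing_is_cvgn; exact: nondecreasing_einfs.
  by apply: nearW => k; apply: le_ereal_inf_tmp => _ [j _ <-]; rewrite lee_fin sqr_ge0.
- apply: (emeasurable_fun_cvg (fun n w => einfs (fun k => (Y k w ^+ 2)%:E) n)).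
    by move=> n; exact: measurable_fun_einfs.
  move=> w _; rewrite limn_einf_lim.
  by apply: ereal_nondecreasing_is_cvgn; exact: nondecreasing_einfs.
apply: filterS YX => w YXw _.
rewrite (_ : limn_einf _ = (X w ^+ 2)%:E)//.
have /cvg_limn_einf_sup[-> _]// : (Y k w ^+ 2)%:E @[k --> \oo] --> (X w ^+ 2)%:E.
by apply: cvg_EFin; [exact: nearW|apply: (cvg_comp _ (fun x => x ^+ 2) YXw); exact: sqr_continuous].
Qed.

Definition clamp (K x : R) : R := Num.max (- K) (Num.min K x).

(** Outside [[-K, K]] the error is [|x| - K <= |x| <= x^2 / K]. *)
Lemma clamp_error (K x : R) : 0 < K -> `|x - clamp K x| <= x ^+ 2 / K.
Proof.
move=> K0; rewrite ler_pdivlMr// /clamp.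
case: (ltP x K) => [xK|Kx].
  case: (ltP (- K) x) => [Kx'|xK'].
    by rewrite subrr normr0 mul0r sqr_ge0.
  rewrite opprK ler0_norm; nra.
rewrite max_r; last by lra.
by rewrite ger0_norm; nra.
Qed.

Lemma clamp_le (K x : R) : 0 < K -> `|clamp K x| <= K.
Proof.
move=> K0; rewrite ler_norml /clamp le_max lexx/= ge_max ge_min lexx andbT/=.
lra.
Qed.

Lemma continuous_clamp (K : R) : continuous (clamp K).
Proof.
move=> x; apply: (@continuous_max R R^o (cst (- K)) (fun x => Num.min K x)); first exact: cst_continuous.
by apply: (@continuous_min R R^o (cst K) id); [exact: cst_continuous|].
Qed.

(* An L^2 bound makes the error of truncation at level K of order 1/K,
   uniformly in k. *)
Lemma Rintegral_cvg0_square_bounded (Y : nat -> T -> R) X (M : R) :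
  (forall k, measurable_fun setT (Y k)) -> measurable_fun setT X ->
  {ae P, forall w, Y k w @[k --> \oo] --> X w} ->
  (forall k, (\int[P]_w ((Y k w) ^+ 2)%:E <= M%:E)%E) ->
  (forall k, \int[P]_w (Y k w) = 0) -> \int[P]_w (X w) = 0.
Proof.
move=> mY mX YX YM Y0; have XM := fatou_square mY mX YX YM.
have trunc (K : R) (V : T -> R) : 0 < K -> measurable_fun setT V ->
    (\int[P]_w ((V w) ^+ 2)%:E <= M%:E)%E ->
    P.-integrable setT (EFin \o (clamp K \o V)) /\
    `|\int[P]_w (V w) - \int[P]_w (clamp K (V w))| <= M / K.
  move=> K0 mV VM.
  have mc : measurable_fun setT (clamp K \o V).
    apply: measurableT_comp => //; apply: continuous_measurable_fun.
    exact: continuous_clamp.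
  have ic : P.-integrable setT (EFin \o (clamp K \o V)).
    by apply: (@bounded_integrable_prob _ _ K) => // w _; exact: clamp_le.
  have iV := square_integrable_integrable mV VM.
  split => //; rewrite -RintegralB//.
  have iVc : P.-integrable setT (EFin \o (fun w => V w - clamp K (V w))).
    exact: (@integrableB _ _ _ P _ _ _ _ iV ic).
  apply: le_trans (le_normr_Rintegral _ iVc) _ => //.
  rewrite -lee_fin /Rintegral fineK; last first.
    by apply: integrable_fin_num => //; exact: integrable_norm.
  apply: (@le_trans _ _ (\int[P]_w ((K^-1)%:E * ((V w) ^+ 2)%:E))%E).
    apply: ge0_le_integral => //.
    - by apply/measurable_EFinP; apply: measurableT_comp => //; exact: measurable_funB.
    - by apply: measurable_funeM; apply/measurable_EFinP; exact: measurable_funX.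
    - by move=> w _; rewrite -EFinM lee_fin mulrC clamp_error.
  rewrite ge0_integralZl//.
  - by rewrite mulrC EFinM lee_wpmul2l// lee_fin invr_ge0 ltW.
  - by apply/measurable_EFinP; exact: measurable_funX.
  - by move=> w _; rewrite lee_fin sqr_ge0.
  - by rewrite lee_fin invr_ge0 ltW.
have M0 : 0 <= M.
  by rewrite -lee_fin; apply: le_trans XM; apply: integral_ge0 => w _; rewrite lee_fin sqr_ge0.
have bound (K : R) : 0 < K -> `|\int[P]_w (X w)| <= M / K + M / K.
  move=> K0; have [icX eX] := trunc K X K0 mX XM.
  have cv : \int[P]_w (clamp K (Y k w)) @[k --> \oo] --> \int[P]_w (clamp K (X w)).
    apply: fine_cvg; rewrite fineK; last exact: integrable_fin_num.
    have [] := @dominated_convergence _ _ R P setT measurableT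
      (fun k w => (clamp K (Y k w))%:E) (fun w => (clamp K (X w))%:E) (cst K%:E).
    - by move=> k; case/integrableP: (trunc K _ K0 (mY k) (YM k)).1.
    - by case/integrableP: icX.
    - apply: filterS YX => w YXw _; apply: cvg_EFin; first exact: nearW.
      by apply: (cvg_comp _ (clamp K) YXw); exact: continuous_clamp.
    - exact: finite_measure_integrable_cst.
    - by apply: aeW => w k _; rewrite lee_fin; exact: clamp_le.
    by [].
  have cX : `|\int[P]_w (clamp K (X w))| <= M / K.
    have cvn : `|\int[P]_w (clamp K (Y k w))| @[k --> \oo] --> `|\int[P]_w (clamp K (X w))|.
      exact: cvg_norm.
    rewrite -(cvg_lim _ cvn)//; apply: limr_le; first by apply/cvg_ex; eexists; exact: cvn.
    apply: nearW => k; have [_] := trunc K _ K0 (mY k) (YM k).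
    by rewrite Y0 sub0r normrN.
  rewrite -[X in `|X|](subrK (\int[P]_w (clamp K (X w)))).
  by apply: le_trans (ler_normD _ _) _; exact: lerD.
apply/eqP; rewrite -normr_le0; apply/ler_addgt0Pl => e e0; rewrite addr0.
(* This level makes [2 M / K] at most [e]; the [+ 1] keeps it positive when [M = 0]. *)
apply: le_trans (bound ((M + M + 1) / e) _) _.
  by rewrite divr_gt0// ltr_wpDl// addr_ge0.
rewrite invf_div mulrA -mulrDl -mulrDl ler_pdivrMr ?ltr_wpDl ?addr_ge0//.
by rewrite mulrC ler_wpM2l ?lerDl// ltW.
Qed.

End UniformIntegrability.

(** * Discretized stopping times *)

Section DiscretizedTime.
Context {R : realType} {Omega : Type} (tau : Omega -> \bar R).
Implicit Types (h : R) (N : nat) (w : Omega).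

(** The strict inequality makes this the complement of [tau <= N h], an event known at time [N h]:
    whether the next step is taken is decided without looking ahead. *)
Definition active h N : set Omega := [set w | ((N%:R * h)%:E < tau w)%E].

(* [h * steps h N w] is [tau w] rounded up to the grid [h * nat] and capped at [N * h]. *)
Definition steps h N w : nat := (\sum_(j < N) ((j%:R * h)%:E < tau w)%E)%N.

(** The family [u] is indexed by the step reached, so that space-time functions can be stopped; a
    constant family gives a function of the stopped process. *)
Definition stopped {X : Type} (u : nat -> X -> R) (Z : R -> Omega -> X) h N w : R :=
  u (steps h N w) (Z ((steps h N w)%:R * h) w).

Lemma stepsS h N w : steps h N.+1 w = (steps h N w + ((N%:R * h)%:E < tau w)%E)%N.
Proof. by rewrite /steps big_ord_recr. Qed.

Lemma steps_le h N w : (steps h N w <= N)%N.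
Proof.
elim: N => [|N IH]; first by rewrite /steps big_ord0.
by rewrite stepsS -addn1 leq_add// leq_b1.
Qed.

Lemma steps_active h N w : 0 < h -> active h N w -> steps h N w = N.
Proof.
move=> h0; rewrite /active/=; elim: N => [|N IH] Nw; first by rewrite /steps big_ord0.
have Nw' : ((N%:R * h)%:E < tau w)%E.
  by apply: le_lt_trans Nw; rewrite lee_fin ler_wpM2r ?ler_nat// ltW.
by rewrite stepsS IH// Nw' addn1.
Qed.

Lemma steps_inactive h N w : ~ active h N w -> steps h N.+1 w = steps h N w.
Proof. by move=> /negP/negbTE naw; rewrite stepsS naw addn0. Qed.

Lemma steps_ub h N w : 0 < h -> (0 <= tau w)%E ->
  (((steps h N w)%:R * h)%:E <= tau w + h%:E)%E.
Proof.
move=> h0 t0; elim: N => [|N IH].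
  by rewrite /steps big_ord0 mul0r adde_ge0// lee_fin ltW.
have [aw|naw] := pselect (active h N w); last by rewrite steps_inactive.
rewrite stepsS steps_active//; move: (aw); rewrite /active/= => Nw.
rewrite Nw addn1 -natr1 mulrDl mul1r EFinD; apply: leeD => //.
exact: ltW.
Qed.

Lemma steps_lb h N w : 0 < h -> (0 <= tau w)%E -> (tau w <= (N%:R * h)%:E)%E ->
  (tau w <= ((steps h N w)%:R * h)%:E)%E.
Proof.
move=> h0 t0; elim: N => [|N IH]; first by rewrite /steps big_ord0.
have [aw|naw] := pselect (active h N w).
  rewrite stepsS steps_active//; move: aw; rewrite /active/= => ->.
  by rewrite addn1.
rewrite steps_inactive// => _; apply: IH.
by rewrite leNgt; exact/negP.
Qed.

(** With the next two lemmas, the skeleton of optional stopping by induction on the cap: on the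
    active event the variables for [N] and [N.+1] sit at deterministic times, and off it they
    coincide. *)
Lemma stopped_active {X : Type} (u : nat -> X -> R) Z h N w : 0 < h ->
  active h N w -> stopped u Z h N w = u N (Z (N%:R * h) w).
Proof. by move=> h0 aw; rewrite /stopped steps_active. Qed.

Lemma stoppedS_active {X : Type} (u : nat -> X -> R) Z h N w : 0 < h ->
  active h N w -> stopped u Z h N.+1 w = u N.+1 (Z (N.+1%:R * h) w).
Proof.
move=> h0 aw; rewrite /stopped stepsS steps_active//.
by move: aw; rewrite /active/= => ->; rewrite addn1.
Qed.

Lemma stoppedS_inactive {X : Type} (u : nat -> X -> R) Z h N w :
  ~ active h N w -> stopped u Z h N.+1 w = stopped u Z h N w.
Proof. by move=> aw; rewrite /stopped steps_inactive. Qed.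

Lemma stopped0 {X : Type} (u : nat -> X -> R) Z h w :
  stopped u Z h 0 w = u 0%N (Z 0 w).
Proof. by rewrite /stopped /steps big_ord0 mul0r. Qed.

End DiscretizedTime.

(** * Measurability of the sampled process and the Markov property at fixed times *)

Section BorelFunctions.
Context {R : realType}.

Lemma continuous_borel_measurable (n : nat) (f : 'rV[R]_n.+1 -> R) : continuous f ->
  measurable_fun [set: borel 'rV[R]_n.+1] (f : borel _ -> R).
Proof.
move=> cf; apply: (measurability _ (measurable_realfun.RGenOpens.measurableE R)).
move=> _ [_ [a [b ->] <-]]; rewrite setTI; apply: sub_sigma_algebra.
by apply: open_comp; [move=> z _; exact: cf|exact: interval_open].
Qed.

Lemma continuous_sphere_measurable (n : nat) (f : 'rV[R]_n.+1 -> R) : continuous f ->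
  measurable_fun [set: borel (sphere R n)] ((f \o val) : borel (sphere R n) -> R).
Proof.
move=> cf; apply: (measurability _ (measurable_realfun.RGenOpens.measurableE R)).
move=> _ [_ [a [b ->] <-]]; rewrite setTI; apply: sub_sigma_algebra.
exists (f @^-1` `]a, b[) => //.
by apply: open_comp; [move=> z _; exact: cf|exact: interval_open].
Qed.

End BorelFunctions.

Section StoppedWalsh.
Context {R : realType} {n : nat} (kappa : probability (borel (sphere R n)) R).
Context {d : measure_display} {Omega : measurableType d} (P : probability Omega R).
Context (F : R -> set (set Omega)) (Z : R -> Omega -> 'rV[R]_n.+1).
Hypothesis hZ : is_walsh_brownian_motion kappa P F Z.
Variable tau : Omega -> \bar R.
Hypothesis htau : is_stopping_time F tau.
Implicit Types (h t s v : R) (w : Omega) (phi : 'rV[R]_n.+1 -> R).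

Lemma sub_filtration t (A : set Omega) : 0 <= t -> F t A -> measurable A.
Proof. by move=> t0; case: (walsh_filtration hZ) => _ /(_ t t0) + _; apply. Qed.

Lemma measurable_walsh t : 0 <= t ->
  measurable_fun setT (Z t : Omega -> borel 'rV[R]_n.+1).
Proof.
move=> t0 _ B mB; rewrite setTI.
exact: sub_filtration t0 (walsh_adapted hZ t0 mB).
Qed.

Lemma measurable_walsh_comp t (f : 'rV[R]_n.+1 -> R) : 0 <= t -> continuous f ->
  measurable_fun setT (fun w => f (Z t w)).
Proof.
move=> t0 cf; apply: (measurableT_comp (f := (f : borel 'rV[R]_n.+1 -> R))
  (g := (Z t : Omega -> borel 'rV[R]_n.+1))).
  exact: continuous_borel_measurable.
exact: measurable_walsh.
Qed.

Lemma active_filtration h N : 0 < h -> F (N%:R * h) (active tau h N).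
Proof.
move=> h0; have Nh0 : 0 <= N%:R * h by rewrite mulr_ge0// ltW.
have [/(_ _ Nh0)[_ FC _] _ _] := walsh_filtration hZ.
rewrite (_ : active tau h N = setT `\` [set w | (tau w <= (N%:R * h)%:E)%E]).
  by apply: FC; exact: htau.2.
apply/seteqP; split=> w /=; rewrite /active/= ltNge.
  by move=> /negP.
by move=> [_ /negP].
Qed.

Lemma measurable_active h N : 0 < h -> measurable (active tau h N).
Proof.
move=> h0; apply: (@sub_filtration (N%:R * h)); first by rewrite mulr_ge0// ltW.
exact: active_filtration.
Qed.

Lemma measurable_tau : measurable_fun setT tau.
Proof.
apply: (measurability _ (ErealGenOInfty.measurableE R)) => // _ [_ [x ->] <-].
rewrite setTI.
have [x0|x0] := leP 0 x.
  rewrite (_ : _ @^-1` _ = ~` [set w | (tau w <= x%:E)%E]).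
    apply: measurableC; exact: (sub_filtration x0 (htau.2 x x0)).
  apply/seteqP; split=> w /=; rewrite in_itv/= andbT ltNge.
    by move=> /negP.
  by move=> /negP.
rewrite (_ : _ @^-1` _ = setT)//; apply/seteqP; split=> w //= _.
by rewrite in_itv/= andbT; apply: lt_le_trans (htau.1 w); rewrite lte_fin.
Qed.

Lemma measurable_steps h N : 0 < h -> measurable_fun setT (fun w => (steps tau h N w)%:R : R).
Proof.
move=> h0; elim: N => [|N IH].
  by under eq_fun do rewrite /steps big_ord0; exact: measurable_cst.
under eq_fun do rewrite stepsS natrD.
apply: measurable_funD => //.
rewrite (_ : (fun w => _) = \1_(active tau h N)).
  by apply: measurable_indic; exact: measurable_active.
apply/funext => w; rewrite indicE; congr (_%:R); congr nat_of_bool.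
by apply/idP/idP; rewrite inE.
Qed.

Lemma measurable_stopped (u : nat -> 'rV[R]_n.+1 -> R) h N : 0 < h ->
  (forall j, continuous (u j)) -> measurable_fun setT (stopped tau u Z h N).
Proof.
move=> h0 cu.
have m j : measurable_fun setT (fun w => u j (Z (j%:R * h) w)).
  by apply: measurable_walsh_comp => //; rewrite mulr_ge0// ltW.
elim: N => [|N IH].
  rewrite (_ : stopped _ _ _ _ _ = fun w => u 0%N (Z 0 w)); last first.
    by apply/funext => w; rewrite stopped0.
  exact: measurable_walsh_comp.
rewrite (_ : stopped _ _ _ _ _ = fun w => if (w \in active tau h N) then
   u N.+1 (Z (N.+1%:R * h) w) else stopped tau u Z h N w).
  apply: measurable_fun_ifT => //.
  apply: (measurable_fun_bool true); rewrite setTI.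
  rewrite (_ : _ @^-1` _ = active tau h N); first exact: measurable_active.
  by apply/seteqP; split=> w /=; [exact: set_mem|exact: mem_set].
apply/funext => w; case: ifPn => [|/negP aw].
  by rewrite inE => aw; rewrite stoppedS_active.
by rewrite stoppedS_inactive// => aw'; apply: aw; rewrite inE.
Qed.

(** A constant time is a finite stopping time, and every event of [F s] belongs to its stopped
    sigma-algebra, because its trace on [s <= t] is either the event itself or empty. *)
Lemma markov_constant_time s h (A : set Omega) f : 0 <= s -> 0 < h -> F s A ->
  C0 kappa f ->
  \int[P]_(w in A) f (Z (s + h) w) = \int[P]_(w in A) walsh_semigroup kappa h f (Z s w).
Proof.
move=> s0 h0 FA Cf; have [Fs _ Fm] := walsh_filtration hZ.
have st : is_stopping_time F (cst s%:E).
  split=> [w|t t0]; first by rewrite lee_fin.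
  have [F0 FC _] := Fs t t0.
  have [st|ts] := leP s t.
    rewrite (_ : mkset _ = setT `\` set0); first exact: FC.
    by apply/seteqP; split=> w /= _; [split|rewrite lee_fin].
  rewrite (_ : mkset _ = set0)//; apply/seteqP; split=> w //=.
  by rewrite lee_fin leNgt ts.
have FTA : stopped_sigma_algebra F (cst s%:E) A.
  split=> [|t t0]; first exact: sub_filtration FA.
  have [st'|ts] := leP s t.
    rewrite (_ : A `&` _ = A); first exact: Fm FA.
    by apply/seteqP; split=> [w []//|w Aw]; split => //=; rewrite lee_fin.
  rewrite (_ : A `&` _ = set0); first by have [] := Fs t t0.
  by apply/seteqP; split=> w //= [_]; rewrite lee_fin leNgt ts.
have := walsh_strong_markov hZ st Cf h0 FTA.
rewrite (_ : A `&` _ = A)//.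
by apply/seteqP; split=> [w []//|w Aw]; split => //=; exact: ltry.
Qed.

End StoppedWalsh.

(** Made for a right-hand side that may be infinite, as the second moment of [Z s] may be before it
    is bounded: an infinite integral is trivially an upper bound, a finite one makes [b]
    integrable. *)
Lemma integral_le_ge0 {R : realType} d (T : measurableType d)
    (mu : {measure set T -> \bar R}) (A : set T) (a b : T -> R) :
  measurable A -> mu.-integrable A (EFin \o a) -> measurable_fun A b ->
  (forall x, 0 <= b x) -> (forall x, a x <= b x) ->
  (\int[mu]_(x in A) (a x)%:E <= \int[mu]_(x in A) (b x)%:E)%E.
Proof.
move=> mA ia mb b0 ab; have mb' : measurable_fun A (EFin \o b) by exact/measurable_EFinP.
have bE : (\int[mu]_(x in A) `|(EFin \o b) x| = \int[mu]_(x in A) (b x)%:E)%E.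
  by apply: eq_integral => x _; rewrite gee0_abs// lee_fin.
have [fin|] := ltP (\int[mu]_(x in A) (b x)%:E)%E +oo%E; last first.
  by rewrite leye_eq => /eqP ->; rewrite leey.
apply: le_integral => //; last by move=> x _; rewrite lee_fin.
by apply/integrableP; split => //; rewrite bE.
Qed.

(** * Growth of the second moment over one time step *)

Section Moments.
Context {R : realType} {n : nat} (kappa : probability (borel (sphere R n)) R).
Context {d : measure_display} {Omega : measurableType d} (P : probability Omega R).
Context (F : R -> set (set Omega)) (Z : R -> Omega -> 'rV[R]_n.+1).
Hypothesis hZ : is_walsh_brownian_motion kappa P F Z.
Implicit Types (h t s v : R) (w : Omega).

Lemma continuous_enorm_sqr : continuous (fun z : 'rV[R]_n.+1 => enorm z ^+ 2).
Proof.
move=> z; apply: (@continuous_comp _ _ _ (@enorm R n) (fun x : R => x ^+ 2)).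
  exact: enorm_continuous.
exact: sqr_continuous.
Qed.

(** With [x = y^2] the left-hand side is [2 v (1 - 1 / (1 + x / (2 v)))], so this is
    [exp (- a) <= 1 / (1 + a)]. That side increases to [y^2] as [v] grows, so it is a smooth
    truncation of the square. *)
Lemma gaussian_defect_lb v (y : R) : 0 < v ->
  y ^+ 2 - (y ^+ 2) ^+ 2 / (v *+ 2 + y ^+ 2) <=
  v *+ 2 * (1 - (Num.sqrt (v * pi *+ 2)) * normal_pdf 0 (Num.sqrt v) y).
Proof.
move=> v0; have p0 : 0 < v * pi *+ 2 by rewrite mulrn_wgt0// mulr_gt0// pi_gt0.
rewrite normal_pdf_sqrtE// mulVKf ?gt_eqF ?sqrtr_gt0// subr0 mulNr expRN.
set x := y ^+ 2; have x0 : 0 <= x by exact: sqr_ge0.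
have v20 : 0 < v *+ 2 by rewrite mulrn_wgt0.
have -> : x - x ^+ 2 / (v *+ 2 + x) = v *+ 2 * (1 - (1 + x / (v *+ 2))^-1).
  by field; rewrite !gt_eqF//; lra.
rewrite ler_pM2l// lerD2l lerN2 lef_pV2 ?posrE ?expR_gt0 ?expR_ge1Dx//.
by rewrite ltr_wpDr// divr_ge0// ltW.
Qed.

(** The ratio of normalizations [sqrt (v / (v + h))] is at least [exp (- h / (2 v))], and enlarging
    the variance enlarges the exponential; the product is then at least [1 - (h + y^2) / (2 v)] by
    [1 + x <= exp x]. *)
Lemma gaussian_defect_ub v h (y : R) : 0 < v -> 0 < h ->
  v *+ 2 * (1 - Num.sqrt (v * pi *+ 2) * normal_pdf 0 (Num.sqrt (v + h)) y) <=
  y ^+ 2 + h.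
Proof.
move=> v0 h0; have v20 : 0 < v *+ 2 by rewrite mulrn_wgt0.
have vh0 : 0 < v + h by rewrite addr_gt0.
have p0 : 0 < pi :> R by exact: pi_gt0.
rewrite normal_pdf_sqrtE// subr0 mulrA.
have -> : Num.sqrt (v * pi *+ 2) * (Num.sqrt ((v + h) * pi *+ 2))^-1 = Num.sqrt (v / (v + h)).
  have p1 : 0 <= v * pi *+ 2 by rewrite mulrn_wge0// ltW// mulr_gt0.
  have p2 : 0 <= (v + h) * pi *+ 2 by rewrite mulrn_wge0// ltW// mulr_gt0.
  rewrite -sqrtrV// -sqrtrM//.
  congr Num.sqrt; move: (@pi R) p0 {p1 p2} => p p0; field.
  by rewrite (lt0r_neq0 p0) (lt0r_neq0 vh0).
have e1 : expR (- (h / (v *+ 2))) <= Num.sqrt (v / (v + h)).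
  rewrite -[leLHS]ger0_norm ?expR_ge0// -sqrtr_sqr.
  rewrite ler_sqrt; last by rewrite divr_ge0// ltW.
  rewrite -expRM_natl (_ : _ * _ = - (h / v)); last by field; rewrite gt_eqF.
  rewrite expRN -[v / (v + h)]invf_div lef_pV2 ?posrE ?expR_gt0 ?divr_gt0//.
  rewrite (_ : (v + h) / v = 1 + h / v) ?expR_ge1Dx//.
  by field; rewrite gt_eqF.
have e2 : expR (- (y ^+ 2 / (v *+ 2))) <= expR (- y ^+ 2 / ((v + h) *+ 2)).
  rewrite ler_expR mulNr lerN2 ler_wpM2l ?sqr_ge0// lef_pV2 ?posrE ?mulrn_wgt0//.
  by rewrite lerMn2r/= lerDl ltW.
have e3 := ler_pM (expR_ge0 _) (expR_ge0 _) e1 e2.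
have e4 := expR_ge1Dx (- (h / (v *+ 2)) + - (y ^+ 2 / (v *+ 2))).
rewrite expRD in e4.
have e5 := le_trans e4 e3.
rewrite -ler_pdivlMl// lerBlDl -lerBlDr; apply: le_trans e5.
by rewrite le_eqVlt; apply/orP; left; apply/eqP; field; rewrite gt_eqF.
Qed.

(** The defect is affine in the Gaussian, so the Markov property replaces variance [v] at time
    [s + h] by variance [v + h] at time [s]. The two defect bounds turn this equality into the
    inequality for truncated squares, and monotone convergence removes the truncation. *)
Lemma walsh_second_moment_step s h (A : set Omega) : 0 <= s -> 0 < h -> F s A ->
  (\int[P]_(w in A) (enorm (Z (s + h) w) ^+ 2)%:E <=
   \int[P]_(w in A) (enorm (Z s w) ^+ 2 + h)%:E)%E.
Proof.
move=> s0 h0 FA; have mA := sub_filtration hZ s0 FA.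
have sh0 : 0 <= s + h by rewrite addr_ge0// ltW.
pose x w : R := enorm (Z (s + h) w) ^+ 2.
have x0 w : 0 <= x w by exact: sqr_ge0.
have mx : measurable_fun setT x.
  exact: (measurable_walsh_comp hZ sh0 continuous_enorm_sqr).
(* The lower bound of [gaussian_defect_lb] at [v = k + 1]. This form shows monotonicity in [k]; the
   form in [gE] shows the sign. *)
pose g (k : nat) w : R := x w - x w ^+ 2 / (k.+1%:R *+ 2 + x w).
have gE k w : g k w = x w * (k.+1%:R *+ 2) / (k.+1%:R *+ 2 + x w).
  rewrite /g; field; rewrite gt_eqF// ltr_pwDl//.
have mg k : measurable_fun A (fun w => (g k w)%:E).
  apply/measurable_EFinP; apply: measurable_funTS.
  have cf : continuous (fun z : 'rV[R]_n.+1 => enorm z ^+ 2 -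
      (enorm z ^+ 2) ^+ 2 / (k.+1%:R *+ 2 + enorm z ^+ 2)).
    have c2 := continuous_enorm_sqr.
    have c3 : continuous (fun z : 'rV[R]_n.+1 => (k.+1%:R *+ 2 + enorm z ^+ 2)^-1).
      move=> z; apply: (@continuousV R _ (fun z => k.+1%:R *+ 2 + enorm z ^+ 2)).
        by rewrite gt_eqF// ltr_pwDl// sqr_ge0.
      apply: (@continuousD R R^o _ (cst (k.+1%:R *+ 2)) (fun z => enorm z ^+ 2)).
        exact: cst_continuous.
      exact: c2.
    have c4 : continuous (fun z : 'rV[R]_n.+1 => (enorm z ^+ 2) ^+ 2).
      move=> z; apply: (@continuous_comp _ _ _ (fun z : 'rV[R]_n.+1 => enorm z ^+ 2) (fun x : R => x ^+ 2)).
        exact: c2.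
      exact: sqr_continuous.
    move=> z; apply: (@continuousB R R^o _ _ _ z (c2 z)).
    exact: (@continuousM R _ _ _ z (c4 z) (c3 z)).
  exact: (measurable_walsh_comp hZ sh0 cf).
have g0 k w : A w -> (0 <= (g k w)%:E)%E.
  by move=> _; rewrite lee_fin gE; apply: divr_ge0; [exact: mulr_ge0|exact: addr_ge0].
have ndg w : A w -> {homo (fun k => (g k w)%:E) : k l / (k <= l)%N >-> (k <= l)%E}.
  move=> _ k l kl; rewrite lee_fin /g lerD2l lerN2 ler_wpM2l ?sqr_ge0//.
  by rewrite lef_pV2 ?posrE ?ltr_pwDl// lerD2r lerMn2r/= ler_nat.
have cg w : (g k w)%:E @[k --> \oo] --> (x w)%:E.
  apply: cvg_EFin; first exact: nearW.
  apply: (@squeeze_cvgr _ _ _ _ (fun k => x w - x w ^+ 2 * harmonic k) (cst (x w))).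
  - apply: nearW => k; rewrite /g; apply/andP; split.
      rewrite lerD2l lerN2 ler_wpM2l ?sqr_ge0//=.
      by rewrite lef_pV2 ?posrE ?ltr_pwDl// mulr2n -addrA lerDl addr_ge0.
    by rewrite lerBlDl lerDr divr_ge0 ?sqr_ge0// addr_ge0.
  - rewrite -[X in _ --> X]subr0 -[X in _ - X](mulr0 (x w ^+ 2)).
    by apply: cvgB; [exact: cvg_cst|apply: cvgMr; exact: cvg_harmonic].
  - exact: cvg_cst.
have mRh : measurable_fun A (fun w => enorm (Z s w) ^+ 2 + h).
  apply: measurable_funTS; apply: measurable_funD => //.
  exact: (measurable_walsh_comp hZ s0 continuous_enorm_sqr).
have key k : (\int[P]_(w in A) (g k w)%:E <=
    \int[P]_(w in A) (enorm (Z s w) ^+ 2 + h)%:E)%E.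
  pose v : R := k.+1%:R; have v0 : 0 < v by rewrite ltr0n.
  have vh0 : 0 < v + h by rewrite addr_gt0.
  set c := Num.sqrt (v * pi *+ 2).
  pose q t (u : R) w := normal_pdf 0 (Num.sqrt u) (enorm (Z t w)).
  have iq t u : 0 <= t -> 0 < u -> P.-integrable A (EFin \o q t u).
    move=> t0 u0; apply: (@bounded_integrable_prob _ _ _ _ _ _ (normal_peak (Num.sqrt u))) => //.
      apply: measurable_funTS.
      exact: (measurable_walsh_comp hZ t0 (continuous_normal_pdf_enorm u0)).
    move=> w _; rewrite ger0_norm ?normal_pdf_ge0// normal_pdf_ub//.
    by rewrite gt_eqF// sqrtr_gt0.
  have ib t u : 0 <= t -> 0 < u ->
      P.-integrable A (EFin \o (fun w => v *+ 2 * (1 - c * q t u w))).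
    move=> t0 u0.
    have i1 : P.-integrable A (EFin \o (fun w => c * q t u w)).
      exact: (@integrableZl _ _ R P A mA c _ (iq t u t0 u0)).
    have i2 : P.-integrable A (EFin \o (cst (1 : R))).
      exact: finite_measure_integrable_cst.
    have i3 : P.-integrable A (EFin \o (fun w => 1 - c * q t u w)).
      exact: (@integrableB _ _ R P A mA _ _ i2 i1).
    exact: (@integrableZl _ _ R P A mA (v *+ 2) _ i3).
  have Rb t u : 0 <= t -> 0 < u -> \int[P]_(w in A) (v *+ 2 * (1 - c * q t u w)) =
      v *+ 2 * (fine (P A) - c * \int[P]_(w in A) q t u w).
    move=> t0 u0.
    have i1 : P.-integrable A (EFin \o (fun w => c * q t u w)).
      exact: (@integrableZl _ _ R P A mA c _ (iq t u t0 u0)).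
    have i2 : P.-integrable A (EFin \o (cst (1 : R))).
      exact: finite_measure_integrable_cst.
    have i3 : P.-integrable A (EFin \o (fun w => 1 - c * q t u w)).
      exact: (@integrableB _ _ R P A mA _ _ i2 i1).
    rewrite RintegralZl// RintegralB// RintegralZl//; last exact: iq.
    by rewrite Rintegral_cst// mul1r.
  have mk : \int[P]_(w in A) q (s + h) v w = \int[P]_(w in A) q s (v + h) w.
    have := markov_constant_time hZ s0 h0 FA (C0_radial kappa v0).
    by under [in RHS]eq_Rintegral do rewrite walsh_semigroup_radial//.
  have Rab : \int[P]_(w in A) (v *+ 2 * (1 - c * q (s + h) v w)) =
      \int[P]_(w in A) (v *+ 2 * (1 - c * q s (v + h) w)).
    by rewrite (Rb _ _ sh0 v0) (Rb _ _ s0 vh0) mk.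
  apply: (@le_trans _ _ (\int[P]_(w in A) (v *+ 2 * (1 - c * q (s + h) v w))%:E)%E).
    have mq := measurable_int P (ib _ _ sh0 v0).
    have := @ge0_le_integral _ _ R P A mA _ _ (g0 k) (mg k) mq.
    apply.
    by move=> w _; rewrite lee_fin; exact: gaussian_defect_lb.
  have fi t u : 0 <= t -> 0 < u ->
      (\int[P]_(w in A) (v *+ 2 * (1 - c * q t u w))%:E)%E =
      (\int[P]_(w in A) (v *+ 2 * (1 - c * q t u w)))%:E.
    move=> t0 u0; have fn := integrable_fin_num mA (ib t u t0 u0).
    by rewrite /Rintegral fineK.
  rewrite (fi _ _ sh0 v0) Rab -(fi _ _ s0 vh0).
  apply: (integral_le_ge0 mA (ib _ _ s0 vh0) mRh).
    by move=> w; rewrite addr_ge0 ?sqr_ge0 ?(ltW h0).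
  by move=> w; exact: gaussian_defect_ub.
have mc := @cvg_monotone_convergence _ _ R P A mA _ mg g0 ndg.
have -> : (\int[P]_(w in A) (enorm (Z (s + h) w) ^+ 2)%:E)%E =
    (\int[P]_(w in A) limn (fun k => (g k w)%:E))%E.
  by apply: eq_integral => w _; apply/esym/cvg_lim => //; exact: cg.
rewrite -(cvg_lim _ mc)//; apply: lime_le; first by apply/cvg_ex; eexists; exact: mc.
exact: nearW.
Qed.

End Moments.

(** * Optional stopping on the grid *)

Section StoppedMoments.
Context {R : realType} {n : nat} (kappa : probability (borel (sphere R n)) R).
Context {d : measure_display} {Omega : measurableType d} (P : probability Omega R).
Context (F : R -> set (set Omega)) (Z : R -> Omega -> 'rV[R]_n.+1).
Hypothesis hZ : is_walsh_brownian_motion kappa P F Z.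
Hypothesis hZ0 : {ae P, forall w, Z 0 w = 0}.
Variable tau : Omega -> \bar R.
Hypothesis htau : is_stopping_time F tau.
Implicit Types (h t s v : R) (w : Omega) (phi : 'rV[R]_n.+1 -> R).

Let setUCT (A : set Omega) : setT = A `|` ~` A. Proof. by rewrite setUv. Qed.

Let disjC (A : set Omega) : [disjoint A & ~` A]. Proof. exact/disj_setPCl. Qed.

Lemma le_integral_off (A : set Omega) (f g : Omega -> \bar R) : measurable A ->
  measurable_fun setT f -> measurable_fun setT g ->
  (forall w, 0 <= f w)%E -> (forall w, 0 <= g w)%E ->
  (forall w, ~ A w -> f w = g w) ->
  (\int[P]_(w in A) f w <= \int[P]_(w in A) g w)%E ->
  (\int[P]_w f w <= \int[P]_w g w)%E.
Proof.
move=> mA mf mg f0 g0 fg le.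
have mCA := measurableC mA.
rewrite (setUCT A).
rewrite (@ge0_integral_setU _ _ R P A (~` A) mA mCA f) ?(disjC A)//; last by rewrite -setUCT.
rewrite (@ge0_integral_setU _ _ R P A (~` A) mA mCA g) ?(disjC A)//; last by rewrite -setUCT.
apply: leeD => //; rewrite le_eqVlt; apply/orP; left; apply/eqP.
by apply: eq_integral => w; rewrite inE => /fg.
Qed.

(** Raising the cap from [N] to [N.+1] changes the stopped process only on the active event, which
    lies in [F (N h)]; there the one-step inequality costs [h], exactly the increment of
    [steps * h]. *)
Lemma stopped_second_moment h N : 0 < h ->
  (\int[P]_w (stopped tau (fun _ z => enorm z) Z h N w ^+ 2)%:E <=
   \int[P]_w ((steps tau h N w)%:R * h)%:E)%E.
Proof.
move=> h0; pose X N w := stopped tau (fun _ z => enorm z) Z h N w ^+ 2.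
have mX k : measurable_fun setT (X k).
  apply: measurable_funX.
  by apply: (measurable_stopped hZ htau k h0) => _; exact: enorm_continuous.
have ms k : measurable_fun setT (fun w => (steps tau h k w)%:R * h).
  by apply: measurable_funM => //; exact: (measurable_steps hZ htau k h0).
elim: N => [|N IH].
  have -> : (\int[P]_w (stopped tau (fun _ z => enorm z) Z h 0 w ^+ 2)%:E =
             \int[P]_w (cst 0 w))%E.
    apply: ae_eq_integral => //.
      by apply/measurable_EFinP; exact: (mX 0%N).
    by apply: filterS hZ0 => w Zw _; rewrite stopped0 Zw enorm0 expr0n.
  rewrite integral0.
  by apply: integral_ge0 => w _; rewrite lee_fin mulr_ge0// ltW.
pose A := active tau h N.
have mA : measurable A := measurable_active hZ htau N h0.
pose a w : R := h * \1_A w.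
have a0 w : 0 <= a w by rewrite mulr_ge0// ltW.
have ma : measurable_fun setT a by apply: measurable_funM => //; exact: measurable_indic.
have Nh0 : 0 <= N%:R * h by rewrite mulr_ge0// ltW.
have E1 : (\int[P]_w (X N.+1 w)%:E <= \int[P]_w (X N w + a w)%:E)%E.
  apply: (@le_integral_off A) => //.
  - exact/measurable_EFinP.
  - by apply/measurable_EFinP; exact: measurable_funD.
  - by move=> w; rewrite lee_fin sqr_ge0.
  - by move=> w; rewrite lee_fin addr_ge0 ?sqr_ge0.
  - move=> w nAw; rewrite /X stoppedS_inactive// /a indicE memNset// mulr0 addr0//.
  have -> : (\int[P]_(w in A) (X N.+1 w)%:E =
      \int[P]_(w in A) (enorm (Z (N%:R * h + h) w) ^+ 2)%:E)%E.
    apply: eq_integral => w; rewrite inE => Aw; rewrite /X stoppedS_active//.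
    by rewrite -natr1 mulrDl mul1r.
  have -> : (\int[P]_(w in A) (X N w + a w)%:E =
      \int[P]_(w in A) (enorm (Z (N%:R * h) w) ^+ 2 + h)%:E)%E.
    apply: eq_integral => w Aw; rewrite /a indicE Aw mulr1.
    by rewrite /X stopped_active//; rewrite inE in Aw.
  by apply: (walsh_second_moment_step hZ) => //; exact: (active_filtration hZ htau).
apply: le_trans E1 _.
under eq_integral do rewrite EFinD.
rewrite ge0_integralD//; last 4 first.
- by move=> w _; rewrite lee_fin sqr_ge0.
- exact/measurable_EFinP.
- by move=> w _; rewrite lee_fin.
- exact/measurable_EFinP.
have -> : (\int[P]_w ((steps tau h N.+1 w)%:R * h)%:E =
    \int[P]_w ((steps tau h N w)%:R * h)%:E + \int[P]_w (a w)%:E)%E.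
  rewrite -ge0_integralD//; first last.
  - exact/measurable_EFinP.
  - by move=> w _; rewrite lee_fin.
  - exact/measurable_EFinP.
  - by move=> w _; rewrite lee_fin mulr_ge0// ltW.
  apply: eq_integral => w _; rewrite -EFinD stepsS natrD mulrDl; congr (_ + _)%:E.
  rewrite mulrC /a indicE; congr (_ * (nat_of_bool _)%:R).
  by apply/idP/idP; rewrite inE.
exact: leeD.
Qed.

Lemma stopped_second_moment_le h N : 0 < h ->
  (\int[P]_w (stopped tau (fun _ z => enorm z) Z h N w ^+ 2)%:E <=
   \int[P]_w tau w + h%:E)%E.
Proof.
move=> h0; apply: le_trans (stopped_second_moment N h0) _.
apply: (@le_trans _ _ (\int[P]_w (tau w + h%:E))%E).
  apply: ge0_le_integral => //.
  - by move=> w _; rewrite lee_fin mulr_ge0// ltW.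
  - apply/measurable_EFinP; apply: measurable_funM => //.
    exact: (measurable_steps hZ htau N h0).
  - by have mt := measurable_tau hZ htau; apply: emeasurable_funD.
  - by move=> w _; apply: steps_ub => //; exact: htau.1.
have mt := measurable_tau hZ htau.
have hh w : setT w -> (0 <= cst h%:E w)%E by rewrite lee_fin ltW.
rewrite (@ge0_integralD _ _ R P setT measurableT tau (cst h%:E) (fun w _ => htau.1 w) mt hh)//.
by rewrite integral_cst// [X in (_ * X)%E]probability_setT mule1.
Qed.

(** Off the active event nothing changes with the cap; on it the martingale identity is applied
    between two deterministic times. The identity is asked for [j < N] only, because a space-time
    profile is tuned to a fixed horizon. *)
Lemma stopped_martingale (u : nat -> 'rV[R]_n.+1 -> R) (B : nat -> R) h N : 0 < h ->
  (forall j, continuous (u j)) -> (forall j z, `|u j z| <= B j) ->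
  (forall j A, (j < N)%N -> F (j%:R * h) A ->
    \int[P]_(w in A) u j.+1 (Z (j.+1%:R * h) w) =
    \int[P]_(w in A) u j (Z (j%:R * h) w)) ->
  \int[P]_w stopped tau u Z h N w = \int[P]_w u 0%N (Z 0 w).
Proof.
move=> h0 cu uB.
have iX k (A : set Omega) : measurable A -> P.-integrable A (EFin \o stopped tau u Z h k).
  (* At most [k] steps have been taken, so the sum of the first [k.+1] bounds dominates whichever of
     them applies. *)
  move=> mA; apply: (@bounded_integrable_prob _ _ _ _ _ _ (\sum_(j < k.+1) B j)) => //.
    by apply: measurable_funTS; exact: (measurable_stopped hZ htau k h0).
  move=> w _; have sk : (steps tau h k w < k.+1)%N by rewrite ltnS steps_le.
  rewrite (bigD1 (Ordinal sk))//= -[leLHS]addr0; apply: lerD; first exact: uB.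
  by apply: sumr_ge0 => j _; exact: le_trans (normr_ge0 (u j 0)) (uB j 0).
elim: N => [|N IH] mart.
  by apply: eq_Rintegral => w _; rewrite stopped0.
rewrite -IH; last by move=> j A jN; apply: mart; exact: ltnW.
have mA := measurable_active hZ htau N h0.
have mCA := measurableC mA.
rewrite (setUCT (active tau h N)).
rewrite Rintegral_setU ?(disjC _)//; last by apply: iX; rewrite -setUCT.
rewrite Rintegral_setU ?(disjC _)//; last by apply: iX; rewrite -setUCT.
congr (_ + _); last first.
  by apply: eq_Rintegral => w; rewrite inE => naw; rewrite stoppedS_inactive.
transitivity (\int[P]_(w in active tau h N) u N.+1 (Z (N.+1%:R * h) w)).
  by apply: eq_Rintegral => w; rewrite inE => aw; rewrite stoppedS_active.
rewrite mart//; last exact: (active_filtration hZ htau).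
by apply: eq_Rintegral => w; rewrite inE => aw; rewrite stopped_active.
Qed.

(** From [y <= 1 + y^2]: the peak of the density bounds the first term, its quadratic decay the
    second. *)
Lemma homogeneous_profile_bounded phi v C z : 0 < v ->
  (forall z, `|phi z| <= C * enorm z) ->
  `|phi z / v * normal_pdf 0 (Num.sqrt v) (enorm z)| <=
  `|C| / v * (normal_peak (Num.sqrt v) + (Num.sqrt (v * pi *+ 2))^-1 * (v *+ 2)).
Proof.
move=> v0 bphi; set q := normal_pdf 0 _ _.
have q0 : 0 <= q by exact: normal_pdf_ge0.
have qp : q <= normal_peak (Num.sqrt v) by rewrite normal_pdf_ub// gt_eqF// sqrtr_gt0.
have qd := normal_pdf0_decay (enorm z) v0; rewrite -/q in qd.
have v1 : 0 <= v^-1 by rewrite invr_ge0 ltW.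
have e0 := enorm_ge0 z.
rewrite !normrM (ger0_norm q0) (ger0_norm v1).
apply: (@le_trans _ _ (`|C| * v^-1 * (enorm z * q))).
  have bz : `|phi z| <= `|C| * enorm z.
    by apply: le_trans (bphi z) _; rewrite ler_wpM2r// ler_norm.
  by have := ler_wpM2r (mulr_ge0 v1 q0) bz; congr (_ <= _); ring.
apply: ler_wpM2l; first exact: mulr_ge0.
apply: le_trans (lerD qp qd).
have y2 : enorm z <= 1 + enorm z ^+ 2 by nra.
by have := ler_wpM2r q0 y2; rewrite mulrDl mul1r.
Qed.

(** The variance drops by [h] at each step and the semigroup over time [h] adds it back, so the
    profile is a martingale up to step [N]; it starts at the vertex, where [phi] vanishes. Beyond
    [N] truncated subtraction freezes the variance at [v], which keeps every member of the family
    continuous and bounded. *)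
Lemma stopped_homogeneous phi C v h N : continuous phi -> pos_homogeneous phi ->
  (forall z, `|phi z| <= C * enorm z) ->
  kappa.-integrable (measure_support kappa) (EFin \o (phi \o val)) ->
  \int[kappa]_(g in measure_support kappa) phi (val g) = 0 ->
  0 < v -> 0 < h ->
  \int[P]_w stopped tau (fun j z => phi z / (v + (N - j)%N%:R * h) *
     normal_pdf 0 (Num.sqrt (v + (N - j)%N%:R * h)) (enorm z)) Z h N w = 0.
Proof.
move=> cphi hphi bphi iphi phi0 v0 h0.
have vj j : 0 < v + (N - j)%N%:R * h by rewrite ltr_wpDr// mulr_ge0// ltW.
pose b (x : R) : R := `|C| / x * (normal_peak (Num.sqrt x) + (Num.sqrt (x * pi *+ 2))^-1 * (x *+ 2)).
pose u j z := phi z / (v + (N - j)%N%:R * h) *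
     normal_pdf 0 (Num.sqrt (v + (N - j)%N%:R * h)) (enorm z).
have cu j : continuous (u j).
  move=> z; apply: (@continuousM R _ (fun z => phi z / (v + (N - j)%N%:R * h))).
    by apply: (@continuousM R _ phi (cst _)); [exact: cphi|exact: cst_continuous].
  exact: (continuous_normal_pdf_enorm (vj j)).
have ub j z : `|u j z| <= b (v + (N - j)%N%:R * h).
  exact: (homogeneous_profile_bounded z (vj j) bphi).
have mart j A : (j < N)%N -> F (j%:R * h) A ->
    \int[P]_(w in A) u j.+1 (Z (j.+1%:R * h) w) =
    \int[P]_(w in A) u j (Z (j%:R * h) w).
  move=> jN FA.
  have jh0 : 0 <= j%:R * h by rewrite mulr_ge0// ltW.
  (* The only use of [j < N]: truncated subtraction really drops by one here. *)
  have vE : v + (N - j)%N%:R * h = v + (N - j.+1)%N%:R * h + h.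
    by rewrite -subnSK// -natr1 mulrDl mul1r addrA.
  rewrite -natr1 mulrDl mul1r.
  have -> := markov_constant_time hZ jh0 h0 FA (C0_homogeneous kappa (vj j.+1) cphi bphi).
  apply: eq_Rintegral => w _; rewrite /u vE.
  exact: (walsh_semigroup_homogeneous _ (vj j.+1) h0 hphi iphi phi0).
have -> := @stopped_martingale u _ h N h0 cu ub mart.
have E0 : (\int[P]_w (u 0%N (Z 0 w))%:E = \int[P]_w (cst 0 w))%E.
  apply: ae_eq_integral => //.
    by apply/measurable_EFinP; exact: (measurable_walsh_comp hZ (lexx 0) (cu 0%N)).
  apply: filterS hZ0 => w Zw _; rewrite Zw -(scale0r 0) /u hphi//.
  by rewrite !mul0r.
by rewrite /Rintegral E0 integral0.
Qed.

End StoppedMoments.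

(** * Refinement of the grid and passage to the limit *)

Section StoppingLimit.
Context {R : realType} {n : nat} (kappa : probability (borel (sphere R n)) R).
Context {d : measure_display} {Omega : measurableType d} (P : probability Omega R).
Context (F : R -> set (set Omega)) (Z : R -> Omega -> 'rV[R]_n.+1).
Hypothesis hZ : is_walsh_brownian_motion kappa P F Z.
Hypothesis hZ0 : {ae P, forall w, Z 0 w = 0}.
Variable tau : Omega -> \bar R.
Hypothesis htau : is_stopping_time F tau.
Implicit Types (w : Omega) (phi f : 'rV[R]_n.+1 -> R).

(* The mesh goes to 0 while the horizon [mesh k * cap k = k + 1] goes to infinity. *)
Let mesh (k : nat) : R := k.+1%:R^-1.
Let cap (k : nat) : nat := (k.+1 * k.+1)%N.

Let mesh_gt0 k : 0 < mesh k. Proof. by rewrite invr_gt0. Qed.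

Let horizonE k : (cap k)%:R * mesh k = k.+1%:R.
Proof. by rewrite natrM mulfK// pnatr_eq0. Qed.

Lemma steps_cvg w : (tau w < +oo)%E ->
  (steps tau (mesh k) (cap k) w)%:R * mesh k @[k --> \oo] --> fine (tau w).
Proof.
move=> tf; have t0 := htau.1 w.
have tE : tau w = (fine (tau w))%:E by rewrite fineK// ge0_fin_numE.
apply: (@squeeze_cvgr _ _ _ _ (cst (fine (tau w))) (fun k => fine (tau w) + mesh k)).
- near=> k; apply/andP; split.
    rewrite /= -lee_fin -tE; apply: steps_lb => //.
    rewrite horizonE tE lee_fin ltW// -natr1 ltr_wpDr//.
    by near: k; exact: nbhs_infty_gtr.
  by rewrite -lee_fin EFinD -tE; exact: steps_ub.
- exact: cvg_cst.
- rewrite -[X in _ --> X]addr0; apply: cvgD; first exact: cvg_cst.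
  exact: cvg_harmonic.
Unshelve. all: by end_near. Qed.

Lemma stopped_path_cvg w : (tau w < +oo)%E ->
  Z ((steps tau (mesh k) (cap k) w)%:R * mesh k) w @[k --> \oo] --> at_time Z tau w.
Proof.
move=> tf; have /subspace_continuousP c := walsh_continuous hZ (w := w).
have t0 : 0 <= fine (tau w) by rewrite fine_ge0// htau.1.
have A0 : `[0, +oo[%classic (fine (tau w)) by rewrite /= in_itv/= t0.
move=> B nB; have /= wB := c _ A0 B nB.
have Sk := steps_cvg tf wB.
apply: (@filterS _ \oo _ _ _ _ Sk) => k /= Bk; apply: Bk.
by rewrite in_itv/= andbT mulr_ge0// ltW.
Qed.

Lemma stopped_cvg f w : continuous f -> (tau w < +oo)%E ->
  stopped tau (fun _ => f) Z (mesh k) (cap k) w @[k --> \oo] --> f (at_time Z tau w).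
Proof.
by move=> cf tf; apply: (cvg_comp _ f (stopped_path_cvg tf)); exact: cf.
Qed.

(** Obtained as a pointwise limit of discretized variables, in which [Z] is evaluated at finitely
    many times; this bypasses joint measurability in time and outcome. *)
Lemma measurable_at_time_comp f : continuous f ->
  measurable_fun setT (fun w => f (at_time Z tau w)).
Proof.
move=> cf; have mt := measurable_tau hZ htau.
apply: (measurable_fun_cvg (h := fun k w => if (tau w < +oo)%E then
  stopped tau (fun _ => f) Z (mesh k) (cap k) w else f (Z 0 w))).
  move=> k; apply: measurable_fun_ifT.
  - by apply: measurable_fun_lte.
  - exact: (measurable_stopped hZ htau _ (mesh_gt0 k)).
  - exact: (measurable_walsh_comp hZ (lexx 0) cf).
move=> w _; have [tf|] := ltP (tau w) +oo%E; first exact: stopped_cvg.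
rewrite leye_eq => /eqP ty.
(* [fine +oo] is 0, so [at_time] is [Z 0] here, the value assigned to the approximating sequence. *)
by rewrite /at_time ty/=; exact: cvg_cst.
Qed.

Hypothesis hEtau : (\int[P]_w tau w < +oo)%E.

Lemma tau_lty_ae : {ae P, forall w, (tau w < +oo)%E}.
Proof.
have it : P.-integrable setT tau.
  have mt := measurable_tau hZ htau; apply/integrableP; split => //.
  by under eq_integral => w _ do rewrite gee0_abs ?htau.1//.
apply: filterS (integrable_ae measurableT it) => w /(_ Logic.I).
by rewrite ge0_fin_numE ?htau.1.
Qed.

(** The [+ 1] bounds the mesh, which is the cost of rounding up, uniformly in [k]. *)
Let M : R := fine (\int[P]_w tau w) + 1.

Let stopped_le_M k :
  (\int[P]_w (stopped tau (fun _ z => enorm z) Z (mesh k) (cap k) w ^+ 2)%:E <= M%:E)%E.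
Proof.
apply: le_trans (stopped_second_moment_le hZ hZ0 htau (cap k) (mesh_gt0 k)) _.
rewrite /M EFinD fineK; last first.
  by rewrite ge0_fin_numE//; apply: integral_ge0 => w _; exact: htau.1.
by apply: leeD => //; rewrite lee_fin invf_le1// ler1n.
Qed.

Lemma second_moment_at_time :
  (\int[P]_w ((enorm (at_time Z tau w)) ^+ 2)%:E <= M%:E)%E.
Proof.
apply: (fatou_square (Y := fun k => stopped tau (fun _ z => enorm z) Z (mesh k) (cap k))).
- move=> k; apply: (measurable_stopped hZ htau _ (mesh_gt0 k)) => _.
  exact: enorm_continuous.
- exact: (measurable_at_time_comp enorm_continuous).
- by apply: filterS tau_lty_ae => w tf; apply: stopped_cvg => //; exact: enorm_continuous.
- exact: stopped_le_M.
Qed.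

(** Variance of the profile at step [j]: it descends from [cap k] plus the horizon to [cap k]. The
    final variance [(k+1)^2] dominates the horizon [k+1], so all these variances are asymptotically
    equal. *)
Let var (k j : nat) : R := (cap k)%:R + (cap k - j)%N%:R * mesh k.

(** After normalization the profile is [a (V / v)^(3/2) exp (- r^2 / (2 v))], which tends to [a]
    when [V / v] tends to 1 and [v] to infinity. *)
Let profile_normalized (a V v r : R) : 0 < V -> V <= v ->
  V * Num.sqrt (V * pi *+ 2) * (a / v * normal_pdf 0 (Num.sqrt v) r) =
  a * (V / v * Num.sqrt (V / v) * expR (- r ^+ 2 / (v *+ 2))).
Proof.
move=> V0 Vv; have v0 := lt_le_trans V0 Vv.
rewrite normal_pdf_sqrtE// subr0.
have p0 : 0 < pi :> R by exact: pi_gt0.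
have p1 : 0 <= V * pi *+ 2 by rewrite mulrn_wge0// ltW// mulr_gt0.
have p2 : 0 <= v * pi *+ 2 by rewrite mulrn_wge0// ltW// mulr_gt0.
have -> : Num.sqrt (V / v) = Num.sqrt (V * pi *+ 2) * (Num.sqrt (v * pi *+ 2))^-1.
  rewrite -sqrtrV// -sqrtrM//.
  congr Num.sqrt; move: (@pi R) p0 {p1 p2} => p p0; field.
  by rewrite (lt0r_neq0 p0) (lt0r_neq0 v0).
ring.
Qed.

(** The normalized stopped profiles [Y k] have mean 0, are dominated by [|C|] times the norm of the
    stopped process, hence bounded in L^2 uniformly in [k], and converge to [phi] at time [tau]
    wherever [tau] is finite. *)
Lemma homogeneous_mean_at_time phi C : continuous phi -> pos_homogeneous phi ->
  (forall z, `|phi z| <= C * enorm z) ->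
  kappa.-integrable (measure_support kappa) (EFin \o (phi \o val)) ->
  \int[kappa]_(g in measure_support kappa) phi (val g) = 0 ->
  \int[P]_w phi (at_time Z tau w) = 0.
Proof.
move=> cphi hphi bphi iphi phi0.
pose V k : R := (cap k)%:R.
have V0 k : 0 < V k by rewrite ltr0n.
pose c k := V k * Num.sqrt (V k * pi *+ 2).
pose u k j z := phi z / var k j * normal_pdf 0 (Num.sqrt (var k j)) (enorm z).
have Vv k j : V k <= var k j by rewrite lerDl mulr_ge0// ltW.
have v0 k j : 0 < var k j := lt_le_trans (V0 k) (Vv k j).
have cu k j : continuous (u k j).
  move=> z; apply: (@continuousM R _ (fun z => phi z / var k j)).
    by apply: (@continuousM R _ phi (cst _)); [exact: cphi|exact: cst_continuous].
  exact: (continuous_normal_pdf_enorm (v0 k j)).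
have mS k : measurable_fun setT (stopped tau (u k) Z (mesh k) (cap k)).
  exact: (measurable_stopped hZ htau _ (mesh_gt0 k)).
pose Y k w := c k * stopped tau (u k) Z (mesh k) (cap k) w.
pose m k w := steps tau (mesh k) (cap k) w.
pose z k w := Z ((m k w)%:R * mesh k) w.
pose v k w := var k (m k w).
have YE k w : Y k w = phi (z k w) *
    (V k / v k w * Num.sqrt (V k / v k w) * expR (- enorm (z k w) ^+ 2 / (v k w *+ 2))).
  exact: profile_normalized.
have vk0 k w : 0 < v k w by exact: v0.
have Vvk k w : V k <= v k w by exact: Vv.
(* The variance exceeds [V k] by at most the horizon, which equals [mesh k * V k]. *)
have rho k w : 1 - mesh k <= V k / v k w <= 1.
  apply/andP; split; last by rewrite ler_pdivrMr// mul1r.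
  rewrite ler_pdivlMr// mulrBl mul1r lerBlDl.
  have e : v k w <= V k + k.+1%:R.
    rewrite /v /var lerD2l -horizonE ler_wpM2r ?ler_nat ?leq_subr//.
    exact: ltW.
  apply: (le_trans e); rewrite addrC lerD2r.
  apply: (@le_trans _ _ (mesh k * V k)); last by rewrite ler_wpM2l// ltW.
  by rewrite mulrC horizonE.
have rho0 k w : 0 <= V k / v k w by rewrite divr_ge0// ltW.
have Yb k w : `|Y k w| <= `|C| * enorm (z k w).
  rewrite YE normrM -[leRHS]mulr1; apply: ler_pM => //.
    by apply: le_trans (bphi _) _; rewrite ler_wpM2r ?enorm_ge0// ler_norm.
  have /andP[_ r1] := rho k w.
  have s0 : 0 <= V k / v k w * Num.sqrt (V k / v k w) by rewrite mulr_ge0.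
  have e0 := expR_ge0 (- enorm (z k w) ^+ 2 / (v k w *+ 2)).
  rewrite (ger0_norm (mulr_ge0 s0 e0)) -[leRHS]mulr1; apply: ler_pM => //.
    rewrite -[leRHS]mulr1; apply: ler_pM => //.
    by rewrite -[leRHS]sqrtr1 ler_sqrt.
  by rewrite -[leRHS]expR0 ler_expR mulNr oppr_le0 divr_ge0 ?sqr_ge0// mulrn_wge0// ltW.
have mY k : measurable_fun setT (Y k) by apply: measurable_funM.
have Y2 k : (\int[P]_w (Y k w ^+ 2)%:E <= (C ^+ 2 * M)%:E)%E.
  have me : measurable_fun setT (fun w => (enorm (z k w) ^+ 2)%:E).
    have ms := @measurable_stopped _ _ _ _ _ _ _ _ hZ _ htau (fun _ => @enorm R n) _
      (cap k) (mesh_gt0 k) (fun _ => @enorm_continuous R n).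
    by apply/measurable_EFinP; exact: measurable_funX ms.
  apply: (@le_trans _ _ (\int[P]_w ((C ^+ 2)%:E * (enorm (z k w) ^+ 2)%:E))%E).
    apply: ge0_le_integral => //.
    - by move=> w _; rewrite lee_fin sqr_ge0.
    - by apply/measurable_EFinP; apply: measurable_funX; exact: mY.
    - exact: measurable_funeM.
    - move=> w _; rewrite -EFinM lee_fin -exprMn -[leLHS]real_normK ?num_real//.
      rewrite -[leRHS]real_normK ?num_real// ler_sqr ?nnegrE// [leRHS]normrM.
      by rewrite (ger0_norm (enorm_ge0 _)).
  rewrite ge0_integralZl//.
  + rewrite [leRHS]EFinM lee_wpmul2l ?lee_fin ?sqr_ge0//.
    exact: stopped_le_M.
  + by move=> w _; rewrite lee_fin sqr_ge0.
  + by rewrite lee_fin sqr_ge0.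
apply: (@Rintegral_cvg0_square_bounded _ _ _ P Y _ (C ^+ 2 * M)).
- exact: mY.
- exact: measurable_at_time_comp.
- apply: filterS tau_lty_ae => w tf.
  have cz : z k w @[k --> \oo] --> at_time Z tau w by exact: stopped_path_cvg.
  have cm : mesh k @[k --> \oo] --> (0 : R) by exact: cvg_harmonic.
  have cr : V k / v k w @[k --> \oo] --> (1 : R).
    apply: (@squeeze_cvgr _ _ _ _ (fun k => 1 - mesh k) (cst 1)).
    - by apply: nearW => k; exact: rho.
    - by rewrite -[X in _ --> X]subr0; apply: cvgB => //; exact: cvg_cst.
    - exact: cvg_cst.
  have ci : (v k w *+ 2)^-1 @[k --> \oo] --> (0 : R).
    apply: (@squeeze_cvgr _ _ _ _ (cst 0) mesh) => //; last exact: cvg_cst.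
    apply: nearW => k; apply/andP; split.
      by rewrite invr_ge0 mulrn_wge0// ltW.
    rewrite /mesh lef_pV2 ?posrE ?ltr0n ?mulrn_wgt0//.
    apply: (@le_trans _ _ (V k)); first by rewrite /V ler_nat leq_pmulr.
    by apply: (le_trans (Vv k (m k w))); rewrite mulr2n lerDl ltW.
  have cn : enorm (z k w) ^+ 2 @[k --> \oo] --> enorm (at_time Z tau w) ^+ 2.
    by apply: (cvg_comp _ (fun z => enorm z ^+ 2) cz); exact: continuous_enorm_sqr.
  have ce : expR (- enorm (z k w) ^+ 2 / (v k w *+ 2)) @[k --> \oo] --> (1 : R).
    have c0 : - enorm (z k w) ^+ 2 / (v k w *+ 2) @[k --> \oo] --> (0 : R).
      rewrite -[X in _ --> X](mulr0 (- enorm (at_time Z tau w) ^+ 2)).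
      by apply: cvgM => //; exact: cvgN.
    by rewrite -(@expR0 R); apply: (cvg_comp _ expR c0); exact: continuous_expR.
  have cs : Num.sqrt (V k / v k w) @[k --> \oo] --> (1 : R).
    by rewrite -(@sqrtr1 R); apply: (cvg_comp _ Num.sqrt cr); exact: sqrt_continuous.
  have cp : phi (z k w) @[k --> \oo] --> phi (at_time Z tau w).
    by apply: (cvg_comp _ phi cz); exact: cphi.
  have -> : Y^~ w = fun k => phi (z k w) *
    (V k / v k w * Num.sqrt (V k / v k w) * expR (- enorm (z k w) ^+ 2 / (v k w *+ 2))).
    by apply/funext => k; exact: YE.
  rewrite -[X in _ --> X]mulr1; apply: cvgM => //.
  rewrite -[X in _ --> X]mulr1; apply: cvgM => //.
  by rewrite -[X in _ --> X]mulr1; apply: cvgM.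
- exact: Y2.
- move=> k.
  have iY : P.-integrable setT (EFin \o Y k).
    exact: square_integrable_integrable (mY k) (Y2 k).
  have c0 : c k != 0.
    rewrite mulf_neq0 ?gt_eqF// sqrtr_gt0 mulrn_wgt0// mulr_gt0//.
    exact: pi_gt0.
  have SE : stopped tau (u k) Z (mesh k) (cap k) = fun w => (c k)^-1 * Y k w.
    by apply/funext => w; rewrite /Y mulKf.
  have iS : P.-integrable setT (EFin \o stopped tau (u k) Z (mesh k) (cap k)).
    by rewrite SE; exact: (@integrableZl _ _ R P setT measurableT (c k)^-1 _ iY).
  rewrite /Y RintegralZl//.
  by rewrite (stopped_homogeneous hZ hZ0 htau (cap k) cphi hphi bphi iphi phi0) ?mulr0.
Qed.

End StoppingLimit.

(** * Angular identity and disintegration *)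

Section MeasureComplements.
Local Open Scope ereal_scope.
Context {R : realType}.
Import HBNNSimple.

(** Passage from sets to simple functions and then to nonnegative functions by monotone convergence.
    It serves for the disintegration and, with a Dirac kernel, for restricted measures. *)
Lemma integral_mixture d d' (X : measurableType d) (Y : measurableType d')
    (m : {measure set X -> \bar R}) (k : R.-ker X ~> Y) (A : set X)
    (nu : {measure set Y -> \bar R}) (f : Y -> \bar R) :
  measurable A ->
  (forall B, measurable B -> nu B = \int[m]_(x in A) k x B) ->
  measurable_fun setT f -> (forall y, 0 <= f y) ->
  \int[nu]_y f y = \int[m]_(x in A) \int[k x]_y f y.
Proof.
move=> mA nuE mf f0; pose f_ := nnsfun_approx measurableT mf.
have cf y : (f_ n y)%:E @[n --> \oo] --> f y.
  by apply: cvg_nnsfun_approx => // z _.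
have ndf y : {homo (fun n => (f_ n y)%:E) : a b / (a <= b)%N >-> a <= b}.
  by move=> a b ab; rewrite lee_fin; exact/lefP/nd_nnsfun_approx.
have mono (mu : {measure set Y -> \bar R}) :
    \int[mu]_y f y = limn (fun n => \int[mu]_y (f_ n y)%:E).
  rewrite -monotone_convergence//.
  - by apply: eq_integral => y _; apply/esym/cvg_lim => //; exact: cf.
  - by move=> n; exact/measurable_EFinP.
  - by move=> n y _; rewrite lee_fin.
have mkf n : measurable_fun setT (fun x => \int[k x]_y (f_ n y)%:E).
  apply: measurable_fun_integral_kernel.
  - by move=> U mU; exact: measurable_kernel.
  - by move=> y; rewrite lee_fin.
  - exact/measurable_EFinP.
have simple n : \int[nu]_y (f_ n y)%:E = \int[m]_(x in A) \int[k x]_y (f_ n y)%:E.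
  have sE (mu : {measure set Y -> \bar R}) : \int[mu]_y (f_ n y)%:E =
      \sum_(r \in range (f_ n)) r%:E * mu (f_ n @^-1` [set r]).
    by rewrite integralT_nnsfun sintegralE.
  rewrite sE; under [RHS]eq_integral do rewrite sE.
  rewrite ge0_integral_fsum//.
  - apply: eq_fsbigr => r; rewrite inE => -[y _ <-]; rewrite nuE//.
    rewrite ge0_integralZl//; last by rewrite lee_fin.
    by apply: measurable_funTS; exact: measurable_kernel.
  - move=> r; apply: measurable_funeM; apply: measurable_funTS.
    exact: measurable_kernel.
  - move=> r x _; have [r0|r0] := leP 0%R r; first by rewrite mule_ge0.
    by rewrite preimage_nnfun0// measure0 mule0.
rewrite mono; under eq_fun do rewrite simple.
rewrite -monotone_convergence//.
- by apply: eq_integral => x _; rewrite mono.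
- by move=> n; exact: measurable_funTS.
- by move=> n x _; apply: integral_ge0 => y _; rewrite lee_fin.
- move=> x _ a b ab; apply: ge0_le_integral => //.
  + by move=> y _; rewrite lee_fin.
  + exact/measurable_EFinP.
  + exact/measurable_EFinP.
  + by move=> y _; exact: ndf.
Qed.

End MeasureComplements.

Section Density.
Local Open Scope ereal_scope.
Context {R : realType} d d' (T : measurableType d) (U : measurableType d')
  (mu : {measure set T -> \bar R}) (h : T -> \bar R) (p : T -> U).
Hypotheses (mh : measurable_fun setT h) (h0 : forall x, 0 <= h x)
  (mp : measurable_fun setT p).

(** The image under [p] of the measure with density [h]. With [h] the norm and [p] the direction, it
    makes the left-hand side of the angular identity a measure in the angular set. *)
Definition density_image (B : set U) : \bar R := \int[mu]_(x in p @^-1` B) h x.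

Let mpre (B : set U) : measurable B -> measurable (p @^-1` B).
Proof. by move=> mB; rewrite -[_ @^-1` _]setTI; exact: mp. Qed.

Let density_image0 : density_image set0 = 0.
Proof. by rewrite /density_image preimage_set0 integral_set0. Qed.

Let density_image_ge0 B : 0 <= density_image B.
Proof. by apply: integral_ge0 => x _; exact: h0. Qed.

Let density_image_sigma_additive : semi_sigma_additive density_image.
Proof.
move=> B mB tB mUB; rewrite /density_image preimage_bigcup.
rewrite ge0_integral_bigcup//.
- by apply: is_cvg_ereal_nneg_natsum_cond => n _ _; exact: density_image_ge0.
- by move=> k; exact: mpre.
- exact: measurable_funTS.
- move/trivIsetP : tB => tB; apply/trivIsetP => i j _ _ ij.
  by rewrite -preimage_setI tB// preimage_set0.
Qed.

HB.instance Definition _ := isMeasure.Build _ _ _ density_image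
  density_image0 density_image_ge0 density_image_sigma_additive.

Definition density_image_measure : {measure set U -> \bar R} := density_image.

End Density.

Section PositivityFunction.
Context {R : realType} {n : nat}.

(** The distance to the complement; an empty complement is at infinite distance and is treated
    apart. *)
Lemma open_positivity_function (V : set 'rV[R]_n.+1) : open V ->
  exists f : 'rV[R]_n.+1 -> R, continuous f /\
    forall z, 0 <= f z /\ (V z <-> 0 < f z).
Proof.
move=> oV; have [C0|/set0P[a Ca]] := eqVneq (~` V) set0.
  exists (cst 1); split; first exact: cst_continuous.
  move=> z; split; rewrite ?ler01//; split => // _; apply: contrapT => nV.
  by have : (~` V) z by []; rewrite C0.
have dfin z : edist_inf (~` V) z \is a fin_num.
  rewrite ge0_fin_numE ?edist_inf_ge0//; apply: le_lt_trans.
    by apply: ereal_inf_lbound; exists a.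
  rewrite -ge0_fin_numE ?edist_ge0//; apply/edist_finP; exists (`|z - a| + 1) => //=.
  by rewrite -ball_normE/= ltrDl.
exists (fun z => fine (edist_inf (~` V) z)); split.
  move=> z; have c := @edist_inf_continuous _ _ (~` V) z.
  by rewrite /continuous_at -(fineK (dfin z)) in c; exact: fine_cvg c.
move=> z; split; first by rewrite fine_ge0// edist_inf_ge0.
split=> [Vz|].
  have /nbhs_ballP[e /= e0 eV] : nbhs z V by exact: open_nbhs_nbhs.
  apply: (lt_le_trans e0); rewrite -lee_fin fineK//.
  apply: le_ereal_inf_tmp => _ [b Cb <-]; rewrite leNgt; apply/negP => /edist_lt_ball/=.
  by move=> /eV.
by rewrite -lte_fin fineK// => d0; apply: contrapT => nV; rewrite edist_inf0 ?ltxx in d0.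
Qed.

End PositivityFunction.

Section RadialExtension.
Context {R : realType} {n : nat}.
Implicit Types (z : 'rV[R]_n.+1) (G : 'rV[R]_n.+1 -> R).

(** At the origin [G] is evaluated at the zero vector, not at the pole chosen by [direction]; the
    factor [enorm z] makes the value 0 in both readings. *)
Definition radial_extension G z : R := enorm z * G ((enorm z)^-1 *: z).

Lemma radial_extension_homogeneous G : pos_homogeneous (radial_extension G).
Proof.
move=> r z; rewrite le_eqVlt => /predU1P[<-|r0].
  by rewrite scale0r /radial_extension enorm0 !mul0r.
rewrite /radial_extension enormZ gtr0_norm// -mulrA; congr (_ * (_ * G _)).
by rewrite scalerA invfM mulrC mulrA mulfV ?mul1r// gt_eqF.
Qed.

Lemma radial_extension_sphere G (g : sphere R n) :
  radial_extension G (val g) = G (val g).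
Proof. by rewrite /radial_extension enorm_sphere mul1r invr1 scale1r. Qed.

Lemma radial_extension_direction G z :
  radial_extension G z = enorm z * G (val (direction z)).
Proof.
have [->|z0] := eqVneq z 0; first by rewrite /radial_extension enorm0 !mul0r.
by rewrite /radial_extension val_direction.
Qed.

Lemma radial_extension_le G (B : R) z : (forall x, `|G x| <= B) ->
  `|radial_extension G z| <= B * enorm z.
Proof.
move=> GB; rewrite /radial_extension normrM (ger0_norm (enorm_ge0 _)) mulrC.
by rewrite ler_wpM2r ?enorm_ge0.
Qed.

(** The direction is discontinuous at the origin; there continuity comes from the bound on [G] and
    the vanishing norm. *)
Lemma continuous_radial_extension G (B : R) : continuous G ->
  (forall x, `|G x| <= B) -> continuous (radial_extension G).
Proof.
move=> cG GB z; have [->|z0] := eqVneq z 0.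
  (* [B] may be 0, so [B + 1] serves as divisor. *)
  have B0 : 0 < B + 1 by rewrite ltr_pwDr//; exact: le_trans (normr_ge0 (G 0)) (GB 0).
  rewrite /continuous_at {2}/radial_extension enorm0 mul0r.
  suff : radial_extension G x @[x --> (0 : 'rV[R]_n.+1)] --> (0 : R) by [].
  apply/(@cvgrPdist_le R _ _ (nbhs (0 : 'rV[R]_n.+1)) (nbhs_filter _)) => e e0.
  have /(@cvgrPdist_le R _ _ (nbhs (0 : 'rV[R]_n.+1)) (nbhs_filter _)) /(_ _ (divr_gt0 e0 B0)) H := @enorm_continuous R n 0.
  suff K (x : 'rV[R]_n.+1) : `|enorm (0 : 'rV[R]_n.+1) - enorm x| <= e / (B + 1) -> `|0 - radial_extension G x| <= e.
    exact: (@filterS _ (nbhs (0 : 'rV[R]_n.+1)) (nbhs_filter (0 : 'rV[R]_n.+1)) _ _ K H).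
  rewrite enorm0 !sub0r !normrN (ger0_norm (enorm_ge0 _)) => xe.
  apply: le_trans (radial_extension_le x GB) _.
  rewrite ler_pdivlMr// mulrC in xe; apply: le_trans xe.
  by rewrite ler_wpM2r ?enorm_ge0// lerDl.
have ez : enorm z != 0 by rewrite enorm_eq0.
have V := @cvgV R _ (nbhs z) (nbhs_filter z) _ _ ez (@enorm_continuous R n z).
have N : (enorm x)^-1 *: x @[x --> z] --> (enorm z)^-1 *: z.
  exact: (@cvgZ R _ _ (nbhs z) (nbhs_filter z) _ _ _ _ V (@cvg_id _ (nbhs z))).
have NG : G ((enorm x)^-1 *: x) @[x --> z] --> G ((enorm z)^-1 *: z).
  by apply: (cvg_comp _ G N); exact: cG.
exact: (@cvgM R _ (nbhs z) _ _ _ _ _ (@enorm_continuous R n z) NG).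
Qed.

End RadialExtension.

(** * The angular law deduced from vanishing means of homogeneous functions *)

Section AngularIdentity.
Context {R : realType} {n : nat} (mu : probability (borel 'rV[R]_n.+1) R)
  (kappa : probability (borel (sphere R n)) R).
Implicit Types (z : 'rV[R]_n.+1) (G : 'rV[R]_n.+1 -> R).
Hypothesis mu2 : (\int[mu]_z (enorm z ^+ 2)%:E < +oo)%E.
Hypothesis mean0 : forall phi (C : R), continuous phi -> pos_homogeneous phi ->
  (forall z, `|phi z| <= C * enorm z) ->
  kappa.-integrable (measure_support kappa) (EFin \o (phi \o val)) ->
  \int[kappa]_(g in measure_support kappa) phi (val g) = 0 ->
  \int[mu]_z phi z = 0.

Lemma integrable_enorm : mu.-integrable setT (fun z => (enorm z)%:E).
Proof.
apply: (square_integrable_integrable (M := fine (\int[mu]_z (enorm z ^+ 2)%:E))).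
  exact: measurable_enorm.
by rewrite fineK// ge0_fin_numE//; apply: integral_ge0 => z _; rewrite lee_fin sqr_ge0.
Qed.

Let m : \bar R := (\int[mu]_z (enorm z)%:E)%E.

Lemma mean_norm_fin : m \is a fin_num.
Proof. by apply: integrable_fin_num => //; exact: integrable_enorm. Qed.

Lemma integral_measure_support (f : borel (sphere R n) -> \bar R) :
  measurable_fun setT f -> (forall g, 0 <= f g)%E ->
  (\int[kappa]_(g in measure_support kappa) f g = \int[kappa]_g f g)%E.
Proof.
move=> mf f0; have mS := measurable_measure_support kappa.
rewrite [RHS](@ge0_negligible_integral _ _ _ kappa setT (~` measure_support kappa))//.
- by rewrite setTD setCK.
- exact: measurableC.
- rewrite [LHS](probability_setC kappa mS); apply/eqP.
  by rewrite [X in (1 - X)%E]measure_support1 subee.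
Qed.

Lemma integral_radial_extension G : continuous G -> (forall x, 0 <= G x <= 1) ->
  (\int[mu]_z (radial_extension G z)%:E = (\int[kappa]_g (G (val g))%:E) * m)%E.
Proof.
move=> cG G01; have mS := measurable_measure_support kappa.
have mGv := continuous_sphere_measurable cG.
have iG : kappa.-integrable (measure_support kappa) (EFin \o (G \o val)).
  apply: (@bounded_integrable_prob _ _ _ _ _ _ 1) => //.
    exact: measurable_funTS.
  by move=> g _; have /andP[G0 G1] := G01 (val g); rewrite /= ger0_norm.
pose c := \int[kappa]_(g in measure_support kappa) G (val g).
have i1 : kappa.-integrable (measure_support kappa) (EFin \o cst (1 : R)).
  exact: finite_measure_integrable_cst.
have ic : kappa.-integrable (measure_support kappa) (EFin \o cst c).
  exact: finite_measure_integrable_cst.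
have kS (r : R) : \int[kappa]_(g in measure_support kappa) cst r g = r.
  by rewrite Rintegral_cst// [X in fine X]measure_support1 mulr1.
(* Since [c] lies in [[0, 1]] like [G], the difference [G - c] is bounded by 1, which gives the
   linear bound demanded by [mean0]. *)
have c0 : 0 <= c by apply: Rintegral_ge0 => g _; have /andP[] := G01 (val g).
have c1 : c <= 1.
  rewrite -[leRHS](kS 1); apply: le_Rintegral => // g _.
  by have /andP[] := G01 (val g).
pose Gc x := G x - c.
have cGc : continuous Gc.
  by move=> x; apply: (@continuousB R R^o _ G (cst c)); [exact: cG|exact: cst_continuous].
have Gc1 x : `|Gc x| <= 1.
  have /andP[G0 G1] := G01 x; rewrite ler_norml /Gc; apply/andP; split; lra.
have G1 x : `|G x| <= 1 by have /andP[G0 G1] := G01 x; rewrite ger0_norm.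
have iGc : kappa.-integrable (measure_support kappa) (EFin \o (radial_extension Gc \o val)).
  rewrite (_ : _ \o _ = EFin \o (fun g => G (val g) - c)).
    exact: (@integrableB _ _ _ kappa _ mS _ _ iG ic).
  by apply/funext => g /=; rewrite radial_extension_sphere.
have GcE : \int[kappa]_(g in measure_support kappa) radial_extension Gc (val g) = 0.
  transitivity (\int[kappa]_(g in measure_support kappa) (G (val g) - c)).
    by apply: eq_Rintegral => g _; rewrite radial_extension_sphere.
  have := kS c; rewrite RintegralB// => ->.
  by rewrite subrr.
have M0 := mean0 (continuous_radial_extension cGc Gc1)
  (@radial_extension_homogeneous _ _ Gc) (fun z => radial_extension_le z Gc1) iGc GcE.
have mG : measurable_fun [set: borel 'rV[R]_n.+1] (radial_extension G : borel _ -> R).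
  exact: continuous_borel_measurable (continuous_radial_extension cG G1).
have ie : mu.-integrable setT (EFin \o (enorm : borel 'rV[R]_n.+1 -> R)) := integrable_enorm.
have iE : mu.-integrable setT (EFin \o (radial_extension G : borel 'rV[R]_n.+1 -> R)).
  apply: (le_integrable _ _ _ ie) => //; first exact/measurable_EFinP.
  move=> z _; rewrite /= lee_fin (le_trans (radial_extension_le z G1))// mul1r.
  by rewrite ler_norm.
have ice : mu.-integrable setT (EFin \o ((fun z => c * enorm z) : borel 'rV[R]_n.+1 -> R)).
  exact: (@integrableZl _ _ R mu setT measurableT c _ ie).
have {}M0 : \int[mu]_z (radial_extension G z) = c * \int[mu]_z (enorm z).
  apply/eqP; rewrite -subr_eq0; apply/eqP; rewrite -[RHS]M0 -RintegralZl// -RintegralB//.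
  by apply: eq_Rintegral => z _; rewrite /radial_extension /Gc mulrBr [enorm z * c]mulrC.
have RE : (\int[mu]_z (radial_extension G z)%:E)%E = (\int[mu]_z radial_extension G z)%:E.
  by rewrite /Rintegral fineK//; exact: (integrable_fin_num measurableT iE).
have mE : m = (\int[mu]_z enorm z)%:E by rewrite /Rintegral fineK// mean_norm_fin.
have kE : (\int[kappa]_g (G (val g))%:E)%E = c%:E.
  rewrite -integral_measure_support//.
  - by rewrite /c /Rintegral fineK//; exact: (integrable_fin_num mS iG).
  - exact/measurable_EFinP.
  - by move=> g; have /andP[] := G01 (val g).
by rewrite RE M0 mE kE EFinM.
Qed.

Let enorm_EFin_ge0 z : (0 <= (enorm z)%:E)%E.
Proof. by rewrite lee_fin enorm_ge0. Qed.

Let measurable_enorm_EFin :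
  measurable_fun [set: borel 'rV[R]_n.+1] (fun z : borel _ => (enorm z)%:E).
Proof. by apply/measurable_EFinP; exact: measurable_enorm. Qed.

(** With [f] positive exactly on an open set, [min 1 (k f)] is continuous and increases to its
    indicator, so monotone convergence applies on both sides. Finiteness of [m] lets the limit pass
    through the product. *)
Lemma angular_identity_open (U : set (sphere R n)) : open U ->
  (\int[mu]_(z in direction @^-1` U) (enorm z)%:E = kappa U * m)%E.
Proof.
move=> oU; have [V oV VU] : exists2 V, open V & set_val @^-1` V = U by exact/open_sphereP.
have mU : measurable (U : set (borel (sphere R n))) by exact: sub_sigma_algebra.
have mdU : measurable (direction @^-1` U : set (borel 'rV[R]_n.+1)).
  by rewrite -[_ @^-1` _]setTI; exact: measurable_direction.
have [f [cf fV]] := open_positivity_function oV.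
pose G (k : nat) (x : 'rV[R]_n.+1) : R := Num.min 1 (k%:R * f x).
have cG k : continuous (G k).
  move=> x; apply: (@continuous_min R _ (cst 1) (fun x => k%:R * f x)).
    exact: cst_continuous.
  by apply: (@continuousM R _ (cst k%:R)); [exact: cst_continuous|exact: cf].
have G01 k x : 0 <= G k x <= 1.
  have [f0 _] := fV x.
  by rewrite /G ge_min lexx andbT le_min ler01 mulr_ge0.
have ndG x k l : (k <= l)%N -> G k x <= G l x.
  move=> kl; have [f0 _] := fV x.
  by rewrite /G le_min ge_min lexx/= ge_min ler_wpM2r ?ler_nat ?orbT.
have limG x : G k x @[k --> \oo] --> (\1_V x : R).
  have [f0 [fV1 fV2]] := fV x; have [Vx|nVx] := pselect (V x).
    rewrite indicE mem_set//; apply: cvg_near_cst.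
    have fx := fV1 Vx; near=> k; rewrite /G; apply/eqP; rewrite minElt ifT//.
    rewrite -ltr_pdivrMr//; near: k; exact: nbhs_infty_gtr.
  rewrite indicE memNset//.
  have fx : f x = 0.
    by apply/eqP; rewrite eq_le f0 andbT leNgt; apply/negP => /fV2.
  by under eq_fun do rewrite /G fx mulr0 min_r//; exact: cvg_cst.
have G1 k x : `|G k x| <= 1 by have /andP[? ?] := G01 k x; rewrite ger0_norm.
have mu_cvg : (\int[mu]_z (radial_extension (G k) z)%:E)%E @[k --> \oo] -->
    (\int[mu]_(z in direction @^-1` U) (enorm z)%:E)%E.
  have -> : (\int[mu]_(z in direction @^-1` U) (enorm z)%:E =
      \int[mu]_z (limn (fun k => (radial_extension (G k) z)%:E)))%E.
    rewrite integral_mkcond; apply: eq_integral => z _; apply/esym/cvg_lim => //.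
    have -> : ((fun z => (enorm z)%:E) \_ (direction @^-1` U)) z =
        (enorm z * \1_V (val (direction z)))%:E.
      rewrite patchE indicE -VU; case: ifPn => [|zU].
        by move=> /set_mem Vz; rewrite (mem_set (Vz : V (val (direction z)))) mulr1.
      rewrite (_ : _ \in _ = false) ?mulr0//; apply/negbTE; apply: contra zU.
      by move=> /set_mem Vz; exact/mem_set.
    apply: cvg_EFin; first exact: nearW.
    under eq_fun do rewrite radial_extension_direction.
    by apply: cvgMr; exact: limG.
  apply: cvg_monotone_convergence => //.
  - move=> k; apply/measurable_EFinP; apply: continuous_borel_measurable.
    exact: continuous_radial_extension (cG k) (G1 k).
  - move=> k z _; rewrite lee_fin /radial_extension mulr_ge0 ?enorm_ge0//.
    by have /andP[] := G01 k ((enorm z)^-1 *: z).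
  - by move=> z _ k l kl; rewrite lee_fin ler_wpM2l ?enorm_ge0// ndG.
have kappa_cvg : (\int[kappa]_g (G k (val g))%:E)%E @[k --> \oo] --> kappa U.
  have -> : kappa U = (\int[kappa]_g (limn (fun k => (G k (val g))%:E)))%E.
    transitivity (\int[kappa]_g (\1_U g)%:E)%E; first by rewrite integral_indic// setIT.
    apply: eq_integral => g _; apply/esym/cvg_lim => //.
    apply: cvg_EFin; first exact: nearW.
    rewrite -VU (_ : \1_(_ @^-1` V) g = \1_V (val g)) ?set_valE//.
    exact: limG.
  apply: cvg_monotone_convergence => //.
  - by move=> k; apply/measurable_EFinP; exact: continuous_sphere_measurable.
  - by move=> k g _; rewrite lee_fin; have /andP[] := G01 k (val g).
  - by move=> g _ k l kl; rewrite lee_fin ndG.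
have kappa_cvgm : (\int[kappa]_g (G k (val g))%:E * m)%E @[k --> \oo] --> (kappa U * m)%E.
  by apply: cvgeZr kappa_cvg; exact: mean_norm_fin.
have E k : (\int[mu]_z (radial_extension (G k) z)%:E)%E = (\int[kappa]_g (G k (val g))%:E * m)%E.
  exact: integral_radial_extension.
by rewrite (eq_cvg _ _ E) in mu_cvg; exact: cvg_unique mu_cvg kappa_cvgm.
Unshelve. all: by end_near. Qed.

(** Two finite measures that agree on open sets, a generating family stable under intersection and
    containing the whole sphere. *)
Lemma angular_identity (A : set (borel (sphere R n))) : measurable A ->
  (\int[mu]_(z in direction @^-1` A) (enorm z)%:E = kappa A * m)%E.
Proof.
move=> mA.
have m0 : 0 <= fine m by rewrite fine_ge0//; apply: integral_ge0 => z _.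
pose m1 := density_image_measure mu measurable_enorm_EFin enorm_EFin_ge0
  (@measurable_direction R n).
pose m2 : {measure set (borel (sphere R n)) -> \bar R} := mscale (NngNum m0) kappa.
have m2E B : m2 B = (kappa B * m)%E.
  by rewrite /m2 /= /mscale /= fineK ?mean_norm_fin// muleC.
have m1T : (m1 setT < +oo)%E.
  rewrite /m1/= /density_image preimage_setT -ge0_fin_numE ?mean_norm_fin//.
  by apply: integral_ge0 => z _; rewrite lee_fin enorm_ge0.
have oI : setI_closed (@open (sphere R n)) by move=> B C; exact: openI.
have m12 (B : set (borel (sphere R n))) : @open (sphere R n) B -> m1 B = m2 B.
  by move=> oB; rewrite m2E; exact: angular_identity_open.
rewrite -m2E.
have cov : \bigcup_(_ in [set: nat]) [set: borel (sphere R n)] = setT.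
  by apply: bigcup_const; exists 0%N.
have H := @measure_unique _ R (borel (sphere R n)) (@open (sphere R n)) (fun=> setT)
  erefl oI (fun=> openT) cov m1 m2 m12 (fun=> m1T) A mA.
by rewrite -H.
Qed.

End AngularIdentity.

(** * From the disintegration to first radial moments *)

Section DisintegrationMean.
Local Open Scope ereal_scope.
Context {R : realType}.

Definition pushforward_measure d d' (T1 : measurableType d) (T2 : measurableType d')
    (m : {measure set T1 -> \bar R}) (f : T1 -> T2) (mf : measurable_fun setT f) :
  {measure set T2 -> \bar R}.
Proof. by refine (pushforward m f : {measure set _ -> \bar R}). Defined.

Lemma measurable_id_half_line :
  measurable_fun setT ((fun r : R => r%:E) \_ `[0%R, +oo[).
Proof.
have mI : measurable (`[0%R, +oo[%classic : set R) by [].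
exact: (measurable_restrictT _ mI).1 (@EFin_measurable R _).
Qed.

(** The restriction of [mu] to [A] is the mixture over [A] of Dirac masses, an instance of
    [integral_mixture]. *)
Lemma ge0_integral_mrestr d (T : measurableType d) (mu : {measure set T -> \bar R})
    (A : set T) (mA : measurable A) (f : T -> \bar R) :
  measurable_fun setT f -> (forall x, 0 <= f x) ->
  \int[mrestr mu mA]_x f x = \int[mu]_(x in A) f x.
Proof.
move=> mf f0.
rewrite (@integral_mixture _ _ _ _ _ mu (kdirac (@measurable_id _ T setT)) A)//.
- by apply: eq_integral => x _; rewrite integral_dirac// diracT mul1e.
- move=> B mB; transitivity (\int[mu]_(x in A) (\1_B x)%:E).
    by rewrite integral_indic.
  by apply: eq_integral.
Qed.

Context {n : nat} (mu : probability (borel 'rV[R]_n.+1) R).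

Lemma measurable_radial_mean (D : R.-pker (borel (sphere R n)) ~> R) :
  measurable_fun setT (radial_mean D).
Proof.
rewrite (_ : radial_mean D = fun g => \int[D g]_r ((fun r => r%:E) \_ `[0%R, +oo[) r).
  apply: measurable_fun_integral_kernel => //.
  - by move=> U mU; exact: measurable_kernel.
  - by move=> r; rewrite patchE; case: ifPn => //; rewrite inE/= in_itv/= andbT.
  - exact: measurable_id_half_line.
by apply/funext => g; rewrite /radial_mean integral_mkcond.
Qed.

(** For fixed [A] the measure [B -> polar_law mu (A x B)] on radii is the mixture of the [D g] over
    [A]. By construction it is also an image of [mu] under the norm plus a multiple of the mass at
    0, and integrating [r] against both descriptions gives the two sides. *)
Lemma disintegration_mean (D : R.-pker (borel (sphere R n)) ~> R)
    (A : set (borel (sphere R n))) : mu [set 0%R] < 1 ->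
  is_disintegration mu D -> measurable A ->
  \int[angular_law mu]_(g in A) radial_mean D g =
  \int[mu]_(z in direction @^-1` A) (enorm z)%:E.
Proof.
move=> k1 [D1 DE] mA.
pose k := fine (mu [set 0%R]); have m0 := @measurable_origin R n.
have kE : mu [set 0%R] = k%:E by rewrite fineK// fin_num_measure.
have c0 : (0 <= k / (1 - k))%R.
  rewrite divr_ge0 ?fine_ge0// subr_ge0 -lee_fin -kE; exact: probability_le1.
have mdA : measurable (direction @^-1` A : set (borel 'rV[R]_n.+1)).
  by rewrite -[_ @^-1` _]setTI; exact: measurable_direction.
have mPA : measurable (punctured `&` direction @^-1` A : set (borel 'rV[R]_n.+1)).
  by apply: measurableI => //; exact: measurable_punctured.
pose muA : {measure set (borel 'rV[R]_n.+1) -> \bar R} := mrestr mu mPA.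
have me : measurable_fun setT (@enorm R n : borel _ -> R) := @measurable_enorm R n.
have mc : measurable_fun setT (cst 0%R : borel 'rV[R]_n.+1 -> R) by [].
pose nu1 := pushforward_measure muA me.
pose nu2 := pushforward_measure muA mc.
pose nu : {measure set R -> \bar R} := measure_add nu1 (mscale (NngNum c0) nu2).
pose ang : {measure set (borel (sphere R n)) -> \bar R} :=
  pushforward_measure (polar_law mu) (@measurable_fst _ _ (borel (sphere R n)) R).
(* The radius cut off to 0 on the negative half-line, so as to be nonnegative on all of [R], where
   the kernel lives. *)
pose f : R -> \bar R := (fun r : R => r%:E) \_ `[0%R, +oo[.
have f0 r : 0 <= f r.
  by rewrite /f patchE; case: ifPn => //; rewrite inE/= in_itv/= andbT.
have mf : measurable_fun setT f := measurable_id_half_line.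
have fe r : (0 <= r)%R -> f r = r%:E.
  by move=> r0; rewrite /f patchE ifT// inE/= in_itv/= r0.
have nuE B : measurable B -> nu B = \int[ang]_(g in A) D g B.
  move=> mB; rewrite -[RHS](DE A B mA mB).
  transitivity (nu1 B + (k / (1 - k))%:E * nu2 B); first exact: measure_addE.
  rewrite /polar_law; congr (_ + _ * _).
    congr (mu _); apply/seteqP; split=> z /=.
      by move=> [Bz [pz Az]]; split.
    by move=> [[Az Bz] pz]; split.
  congr (mu _); apply/seteqP; split=> z /=.
    by move=> [Bz [pz Az]]; split.
  by move=> [[Az Bz] pz]; split.
transitivity (\int[ang]_(g in A) \int[D g]_r f r).
  by apply: eq_integral => g _; rewrite /radial_mean integral_mkcond.
rewrite -(integral_mixture mA nuE mf f0) /nu ge0_integral_measure_add//.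
rewrite ge0_integral_mscale// (ge0_integral_pushforward mc)// (ge0_integral_pushforward me)//.
(* The second image measure sits at radius 0, where [f] vanishes: the extra mass in [polar_law]
   contributes nothing. *)
rewrite [X in _ + _ * X]integral0_eq ?mule0 ?adde0; last by move=> z _; rewrite /= fe.
have mfe : measurable_fun setT (f \o (@enorm R n : borel _ -> R)) := measurableT_comp mf me.
have f0e (z : borel 'rV[R]_n.+1) : 0 <= (f \o @enorm R n) z by exact: f0.
have EA := @ge0_integral_mrestr _ _ mu _ mPA _ mfe f0e.
rewrite preimage_setT EA.
rewrite [LHS]integral_mkcond [RHS]integral_mkcond; apply: eq_integral => z _.
(* Only the punctured space carries [muA], but the omitted origin has norm 0. *)
rewrite !patchE in_setI; have [->|z0] := eqVneq z 0%R.
  by rewrite /= enorm0 fe// !if_same.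
by rewrite (mem_set (z0 : punctured z))/= fe ?enorm_ge0.
Qed.

End DisintegrationMean.

(** * Transfer from the stopped process to its law, and conclusion *)

Section StoppedLaw.
Context {R : realType} {n : nat} (mu : probability (borel 'rV[R]_n.+1) R).
Context {d : measure_display} {Omega : measurableType d} (P : probability Omega R).
Variable Y : Omega -> borel 'rV[R]_n.+1.
Hypothesis hlaw : forall B : set (borel 'rV[R]_n.+1), measurable B -> P (Y @^-1` B) = mu B.
Hypothesis hY : forall f : 'rV[R]_n.+1 -> R, continuous f ->
  measurable_fun setT (fun w => f (Y w)).

(** Each open set is where some continuous function is positive, so continuous real observables of
    [Y] decide its measurability. *)
Lemma measurable_of_continuous_comp : measurable_fun setT Y.
Proof.
apply: (@measurability _ _ Omega (borel 'rV[R]_n.+1) setT Y (@open 'rV[R]_n.+1) erefl).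
move=> _ [U oU <-].
have [f [cf fU]] := open_positivity_function oU.
have -> : setT `&` Y @^-1` U = setT `&` (fun w => f (Y w)) @^-1` `]0, +oo[.
  apply/seteqP; split=> w [_ /= h]; split=> //=.
    by rewrite in_itv/= andbT; exact/(fU (Y w)).2.
  by rewrite in_itv/= andbT in h; exact/(fU (Y w)).2.
by apply: (hY cf).
Qed.

Lemma ge0_integral_law (f : borel 'rV[R]_n.+1 -> \bar R) : measurable_fun setT f ->
  (forall z, 0 <= f z)%E -> (\int[mu]_z f z = \int[P]_w f (Y w))%E.
Proof.
move=> mf f0; have mY := measurable_of_continuous_comp.
rewrite -(@eq_measure_integral _ _ _ setT mu (pushforward P Y)).
  by rewrite ge0_integral_pushforward.
by move=> B mB _; exact: hlaw.
Qed.

Lemma Rintegral_law (f : borel 'rV[R]_n.+1 -> R) : measurable_fun setT f ->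
  \int[mu]_z f z = \int[P]_w f (Y w).
Proof.
move=> mf; have mf' : measurable_fun setT (EFin \o f) by exact/measurable_EFinP.
rewrite /Rintegral integralE [in RHS]integralE; congr fine; congr (_ - _)%E.
  rewrite (ge0_integral_law (measurable_funepos mf') (funepos_ge0 (EFin \o f))).
  by apply: eq_integral => w _; rewrite !funeposE.
rewrite (ge0_integral_law (measurable_funeneg mf') (funeneg_ge0 (EFin \o f))).
by apply: eq_integral => w _; rewrite !funenegE.
Qed.

End StoppedLaw.

(** A zero mean would force the norm to vanish almost everywhere, putting all the mass at the
    origin. *)
Lemma mean_norm_gt0 {R : realType} {n : nat} (mu : probability (borel 'rV[R]_n.+1) R) :
  (mu [set 0%R] < 1 -> 0 < \int[mu]_z (enorm z)%:E)%E.
Proof.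
move=> k1; rewrite lt_neqAle integral_ge0 ?andbT//; last first.
  by move=> z _; rewrite lee_fin enorm_ge0.
apply/negP => /eqP m0.
have me : measurable_fun [set: borel 'rV[R]_n.+1] (fun z : borel _ => (enorm z)%:E).
  by apply/measurable_EFinP; exact: measurable_enorm.
have : (\int[mu]_z `|(enorm z)%:E| = 0)%E.
  by rewrite m0; apply: eq_integral => z _; rewrite gee0_abs// lee_fin enorm_ge0.
move=> /(ae_eq_integral_abs mu measurableT me) ae0.
have : mu.-negligible (punctured : set (borel 'rV[R]_n.+1)).
  apply: negligibleS ae0 => z z0 /= /(_ Logic.I)/= /eqP.
  by rewrite eqe enorm_eq0; exact/negP.
move=> /(measure_negligible (@measurable_punctured R n)) mp0.
have := probability_setC mu (@measurable_punctured R n).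
by rewrite setC_punctured mp0 sube0 => E; rewrite E ltxx in k1.
Qed.

Unset Implicit Arguments.
Set Strict Implicit.
Set Printing Implicit Defensive.

Local Open Scope ereal_scope.

Theorem proposition4p1 (R : realType) (n : nat)
    (mu : probability (borel 'rV[R]_n.+1) R) (hmu : mu [set 0%R] < 1)
    (kappa : probability (borel (sphere R n)) R)
    (d : measure_display) (Omega : measurableType d) (P : probability Omega R)
    (F : R -> set (set Omega)) (Z : R -> Omega -> 'rV[R]_n.+1)
    (hZ : is_walsh_brownian_motion kappa P F Z)
    (hZ0 : {ae P, forall w, Z 0%R w = 0%R})
    (tau : Omega -> \bar R) (htau : is_stopping_time F tau)
    (hlaw : forall B : set (borel 'rV[R]_n.+1), measurable B ->
       P (at_time Z tau @^-1` B) = mu B)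
    (hEtau : \int[P]_w tau w < +oo) :
  let m := \int[mu]_z (enorm z)%:E in
  [/\ 0 < m < +oo,
      forall D : R.-pker (borel (sphere R n)) ~> R, is_disintegration mu D ->
        forall A : set (borel (sphere R n)), measurable A ->
          kappa A = \int[angular_law mu]_(g in A) (radial_mean D g / m) &
      \int[mu]_z (enorm z ^+ 2)%:E < +oo].
Proof.
move=> m.
have hY := measurable_at_time_comp hZ htau.
have mu2 : \int[mu]_z (enorm z ^+ 2)%:E < +oo.
  rewrite (ge0_integral_law hlaw hY).
  - exact: le_lt_trans (second_moment_at_time hZ hZ0 htau hEtau) (ltry _).
  - apply/measurable_EFinP; apply: continuous_borel_measurable.
    exact: continuous_enorm_sqr.
  - by move=> z; rewrite lee_fin sqr_ge0.
have mean0 phi (C : R) : continuous phi -> pos_homogeneous phi ->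
    (forall z, `|phi z| <= C * enorm z)%R ->
    kappa.-integrable (measure_support kappa) (EFin \o (phi \o val)) ->
    (\int[kappa]_(g in measure_support kappa) phi (val g) = 0)%R ->
    (\int[mu]_z phi z = 0)%R.
  move=> cphi hphi bphi iphi phi0.
  rewrite (Rintegral_law hlaw hY (continuous_borel_measurable cphi)).
  exact: (homogeneous_mean_at_time hZ hZ0 htau hEtau cphi hphi bphi iphi phi0).
have m0 : 0 < m := mean_norm_gt0 hmu.
have mfin : m \is a fin_num := mean_norm_fin mu2.
have moo : m < +oo by rewrite -ge0_fin_numE// ltW.
split=> //; first by rewrite m0.
move=> D hD A mA.
have E := disintegration_mean hmu hD mA.
pose ang : {measure set (borel (sphere R n)) -> \bar R} :=
  pushforward_measure (polar_law mu) (@measurable_fst _ _ (borel (sphere R n)) R).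
have rm0 g : A g -> 0 <= radial_mean D g.
  by move=> _; apply: integral_ge0 => r; rewrite /= in_itv/= andbT lee_fin.
have mi0 : 0 <= m^-1 by rewrite inve_ge0 ltW.
have mrm : measurable_fun A (radial_mean D).
  by apply: measurable_funTS; exact: measurable_radial_mean.
(* The factor [1 / m] leaves the integral; what remains is the angular moment [kappa A * m], and [m]
   cancels because it is finite and nonzero. *)
have -> := @ge0_integralZr _ _ R ang A mA _ mrm m^-1 rm0 mi0.
rewrite [X in X / m]E (angular_identity mu2 mean0 mA) -muleA divee ?mule1//.
by rewrite gt_eqF.
Qed.
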